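(* Let $n\ge1$ and $0<p<\infty$. There is a finite constant $E_{p,n}$ such that for all nonnegative functions $F,G\in L^p(\mathbb{H}^n)$, $$\|F\|_{L^p(\mathbb{H}^n)}\,\|G\|_{L^p(\mathbb{H}^n)}\le E_{p,n}\,\sup_{q,t\in\mathbb{H}^n}F(q)G(t)\,|qt-1|^{n/p},$$ where $qt=-q_1t_1-\dots-q_nt_n+q_{n+1}t_{n+1}$. The best constant $E_{p,n}$ is obtained when $F=\mathrm{const}\cdot H$ and $G=\mathrm{const}\cdot H$ (nonzero constants), where $$H(q)=|q_{n+1}|^{-n/p},\qquad q=(q_1,\dots,q_n,q_{n+1}).$$
   Context: $\mathbb{H}^n=\{q=(q_1,\dots,q_n,q_{n+1})\in\mathbb{R}^n\times\mathbb{R}: q_1^2+\dots+q_n^2-q_{n+1}^2=-1\}$ (both sheets), equipped with the measure $d\nu(q)$ invariant under the Lorentz group $O(1,n)$, i.e. $d\nu=dq_1\cdots dq_n/|q_{n+1}|$ on each sheet (up to normalization). $L^p(\mathbb{H}^n)=L^p(\mathbb{H}^n,d\nu)$ with $\|F\|_{L^p}=(\int|F|^p\,d\nu)^{1/p}$ (also for $p<1$). $\sup$ denotes the essential supremum with respect to $\nu\otimes\nu$. *)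

(* Defs.v *)
From HB Require Import structures.
From mathcomp Require Import all_boot all_order all_algebra.
From mathcomp Require Import all_classical all_reals all_analysis.
From mathcomp Require Import measurable_realfun ess_sup_inf.
Import Order.TTheory GRing.Theory Num.Theory.
Import numFieldNormedType.Exports.

Set Implicit Arguments.
Unset Strict Implicit.
Unset Printing Implicit Defensive.

Local Open Scope classical_set_scope.
Local Open Scope ring_scope.

Section cons_measure.
Context {d} {T : measurableType d} {R : realType} {n : nat}.
Variable mu : {sigma_finite_measure set T -> \bar R}.
Variable nu : {sigma_finite_measure set (n.-tuple T) -> \bar R}.

Definition cons_pair (z : T * n.-tuple T) : n.+1.-tuple T :=
  [tuple of z.1 :: z.2].

Lemma measurable_cons_pair : measurable_fun [set: T * n.-tuple T] cons_pair.
Proof. exact: measurable_cons. Qed.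

Definition cons_measure : set (n.+1.-tuple T) -> \bar R :=
  pushforward (mu \x nu)%E cons_pair.

Let mpre A : measurable A -> measurable (cons_pair @^-1` A).
Proof.
by move=> mA; rewrite -[X in measurable X]setTI; exact: measurable_cons_pair.
Qed.

Let cons_measure0 : cons_measure set0 = 0%E.
Proof. by rewrite /cons_measure /pushforward preimage_set0 measure0. Qed.

Let cons_measure_ge0 A : (0 <= cons_measure A)%E.
Proof. by rewrite /cons_measure /pushforward; apply: measure_ge0. Qed.

Let cons_measure_sigma_additive : semi_sigma_additive cons_measure.
Proof.
move=> F mF tF mUF; rewrite /cons_measure /pushforward preimage_bigcup.
apply: measure_semi_sigma_additive.
- by move=> k; apply: mpre; exact: mF.
- apply/trivIsetP => /= i j _ _ ij; rewrite -preimage_setI.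
  by move/trivIsetP : tF => /(_ _ _ _ _ ij) ->//; rewrite preimage_set0.
- by rewrite -preimage_bigcup; apply: mpre; exact: mUF.
Qed.

HB.instance Definition _ := isMeasure.Build _ _ _ cons_measure
  cons_measure0 cons_measure_ge0 cons_measure_sigma_additive.

Let cons_measure_sigma_finite : sigma_finite setT cons_measure.
Proof.
have /sigma_finiteP[F [FT Fnd Foo]] := sigma_finiteT mu.
have /sigma_finiteP[G [GT Gnd Goo]] := sigma_finiteT nu.
pose u (x : n.+1.-tuple T) : T * n.-tuple T := (thead x, [tuple of behead x]).
have mu_ : measurable_fun setT u.
  apply: measurable_fun_pair; last exact: measurable_behead.
  exact: measurable_tnth.
have uK z : u (cons_pair z) = z.
  by case: z => a x; rewrite /u theadE; congr (_, _); apply: val_inj.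
exists (fun k => u @^-1` (F k `*` G k)).
  apply/esym; rewrite -subTset => x _.
  have [i _ Fi] : (\bigcup_i F i) (u x).1 by rewrite -FT.
  have [j _ Gj] : (\bigcup_i G i) (u x).2 by rewrite -GT.
  exists (maxn i j) => //; split.
  - by move: Fi; exact/subsetPset/Fnd/leq_maxl.
  - by move: Gj; exact/subsetPset/Gnd/leq_maxr.
move=> k; have [mF Fk] := Foo k; have [mG Gk] := Goo k.
have mFG : measurable (F k `*` G k) by exact: measurableX.
split; first by rewrite -[X in measurable X]setTI; exact: mu_.
rewrite /cons_measure /pushforward -comp_preimage.
rewrite (_ : u \o cons_pair = id); last by apply/funext => z; exact: uK.
by rewrite preimage_id product_measure1E// lte_mul_pinfty// ge0_fin_numE.
Qed.

HB.instance Definition _ :=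
  Measure_isSigmaFinite.Build _ _ _ cons_measure cons_measure_sigma_finite.

End cons_measure.

Section lebesgue_Rn.
Context {R : realType}.

(* [lebesgue_measure] lives on the alias [measurableTypeR R]; this is the same
   set function, for [R] with its canonical Borel structure. *)
Definition lebesgueR : set R -> \bar R := @lebesgue_measure R.

HB.instance Definition _ := isMeasure.Build _ R R lebesgueR
  (measure0 (@lebesgue_measure R)) (measure_ge0 (@lebesgue_measure R))
  (@measure_semi_sigma_additive _ _ _ (@lebesgue_measure R)).

HB.instance Definition _ := Measure_isSigmaFinite.Build _ R R lebesgueR
  (sigma_finiteT (@lebesgue_measure R)).

Fixpoint lebesgueRn (n : nat) : {sigma_finite_measure set (n.-tuple R) -> \bar R} :=
  match n with
  | 0 => \d_([tuple] : 0.-tuple R)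
  | m.+1 => cons_measure lebesgueR (lebesgueRn m)
  end.

End lebesgue_Rn.
Arguments lebesgueRn : clear implicits.

Section hyperboloid.
Context {R : realType} {n : nat}.
Implicit Types (q t : n.-tuple R * R) (s : bool) (x : n.-tuple R).

Definition minkowski_form q t : R :=
  - (\sum_(i < n) tnth q.1 i * tnth t.1 i) + q.2 * t.2.

Definition on_hyperboloid q : bool :=
  \sum_(i < n) tnth q.1 i ^+ 2 - q.2 ^+ 2 == -1.

Definition height x : R := Num.sqrt (1 + \sum_(i < n) tnth x i ^+ 2).

Let height_sq_ge0 x : 0 <= 1 + \sum_(i < n) tnth x i ^+ 2.
Proof. by rewrite addr_ge0// sumr_ge0// => i _; rewrite sqr_ge0. Qed.

Lemma height_ge1 x : 1 <= height x.
Proof.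
rewrite -[leLHS]sqrtr1 ler_wsqrtr// lerDl sumr_ge0// => i _.
by rewrite sqr_ge0.
Qed.

Lemma sheet_subproof s x : on_hyperboloid (x, (-1) ^+ s * height x).
Proof.
by rewrite /on_hyperboloid/= exprMn sqrr_sign mul1r sqr_sqrtr// opprD addrC
  -addrA addNr addr0.
Qed.

End hyperboloid.

Definition hyperboloid (R : realType) (n : nat) : Type :=
  {q : n.-tuple R * R | on_hyperboloid q}.

Section hyperboloid_measure.
Context {R : realType} {n : nat}.
Local Notation Hn := (hyperboloid R n).

HB.instance Definition _ := Choice.on Hn.

(* The graph parametrization of the two sheets: [s = false] is the sheet
   q_(n+1) > 0 and [s = true] the sheet q_(n+1) < 0. *)
Definition sheet (s : bool) (x : n.-tuple R) : Hn :=
  exist _ (x, (-1) ^+ s * height x) (sheet_subproof s x).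

HB.instance Definition _ := isPointed.Build Hn
  (sheet false [tuple of nseq n 0]).

Definition hval (q : Hn) : n.-tuple R * R := val q.

(* the trace on [Hn] of the Borel sets of R^n * R *)
HB.instance Definition _ := Measurable.copy Hn
  (g_sigma_algebra_preimageType hval).

Lemma measurable_height : measurable_fun [set: n.-tuple R] height.
Proof.
apply: measurableT_comp => //.
  by apply: continuous_measurable_fun; exact: sqrt_continuous.
apply: measurable_funD => //; apply: measurable_sum => i.
by apply: measurable_funX; exact: measurable_tnth.
Qed.

Lemma measurable_hval : measurable_fun [set: Hn] hval.
Proof. by move=> _ B mB; rewrite setTI; exists B => //; rewrite setTI. Qed.

Lemma measurable_sheet s : measurable_fun [set: n.-tuple R] (sheet s).
Proof.
have mh : measurable_fun [set: n.-tuple R] (hval \o sheet s).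
  apply: measurable_fun_pair => //.
  by apply: measurable_funM => //; exact: measurable_height.
move=> _ _ [B mB <-]; rewrite setTI setTI -comp_preimage -[X in measurable X]setTI.
exact: mh.
Qed.

(* d nu = dq_1 ... dq_n / |q_(n+1)| on each of the two sheets *)
Definition lorentz_measure (A : set Hn) : \bar R :=
  (\sum_(s : bool) \int[lebesgueRn R n]_(x in sheet s @^-1` A)
    (`|(hval (sheet s x)).2|^-1)%:E)%E.

Let dens (s : bool) (x : n.-tuple R) : \bar R :=
  (`|(hval (sheet s x)).2|^-1)%:E.

Let densE s x : dens s x = ((height x)^-1)%:E.
Proof.
rewrite /dens/= normrM normr_sign mul1r ger0_norm//.
exact: le_trans (height_ge1 _).
Qed.

Let dens_ge0 s x : (0 <= dens s x)%E.
Proof. by rewrite lee_fin invr_ge0. Qed.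

Let dens_le1 s x : (dens s x <= 1)%E.
Proof. by rewrite densE lee_fin invf_le1 ?height_ge1// (lt_le_trans _ (height_ge1 x)). Qed.

Let mdens s : measurable_fun setT (dens s).
Proof.
apply/measurable_EFinP.
rewrite (_ : (fun x => _) = fun x => (height x)^-1); last first.
  by apply/funext => x; apply: EFin_inj; exact: densE.
rewrite (_ : (fun x => _) = (fun y => y `^ (-1)) \o height); last first.
  by apply/funext => x /=; rewrite powR_inv1// (le_trans _ (height_ge1 x)).
by apply: measurableT_comp measurable_height; exact: measurable_powR.
Qed.

Let msheet s A : measurable A -> measurable (sheet s @^-1` A).
Proof. by move=> mA; rewrite -[X in measurable X]setTI; exact: measurable_sheet. Qed.

Let lorentz_measure0 : lorentz_measure set0 = 0%E.
Proof.
by rewrite /lorentz_measure big1// => s _; rewrite preimage_set0 integral_set0.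
Qed.

Let lorentz_measure_ge0 A : (0 <= lorentz_measure A)%E.
Proof.
by apply: sume_ge0 => s _; apply: integral_ge0 => x _; exact: dens_ge0.
Qed.

Let lorentz_measure_sigma_additive : semi_sigma_additive lorentz_measure.
Proof.
move=> F mF tF mUF.
have sF s : trivIset setT (fun k => sheet s @^-1` F k).
  apply/trivIsetP => /= i j _ _ ij; rewrite -preimage_setI.
  by move/trivIsetP : tF => /(_ _ _ _ _ ij) ->//; rewrite preimage_set0.
have H s : ((fun k => \sum_(0 <= i < k)
      \int[lebesgueRn R n]_(x in sheet s @^-1` F i) dens s x) @ \oo -->
    \int[lebesgueRn R n]_(x in sheet s @^-1` (\bigcup_k F k)) dens s x)%E.
  rewrite preimage_bigcup.
  apply: (@semi_sigma_additive_nng_induced _ _ _ (lebesgueRn R n) _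
    (mdens s) (dens_ge0 s)) => //.
  - by move=> k; apply: msheet; exact: mF.
  - by rewrite -preimage_bigcup; apply: msheet; exact: mUF.
rewrite /lorentz_measure big_bool.
under eq_fun do rewrite (eq_bigr _ (fun i _ => big_bool _ _)) big_split.
apply: cvgeD; [|exact: H|exact: H].
by apply: ge0_adde_def; rewrite inE integral_ge0.
Qed.

HB.instance Definition _ := isMeasure.Build _ _ _ lorentz_measure
  lorentz_measure0 lorentz_measure_ge0 lorentz_measure_sigma_additive.

Let lorentz_measure_sigma_finite : sigma_finite setT lorentz_measure.
Proof.
have /sigma_finiteP[F [FT Fnd Foo]] := sigma_finiteT (lebesgueRn R n).
exists (fun k => (fst \o hval) @^-1` F k).
  by rewrite -preimage_bigcup -FT.
move=> k; have [mF Fk] := Foo k; split.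
  rewrite -[X in measurable X]setTI.
  by apply: (measurableT_comp measurable_fst measurable_hval).
apply: lte_sum_pinfty => s _.
rewrite -comp_preimage (_ : _ \o sheet s = id)// preimage_id.
apply: le_lt_trans Fk; rewrite -[leRHS]mul1e -integral_cst//.
apply: ge0_le_integral => //.
- by apply: measurable_funTS; exact: mdens.
- by move=> x _; exact: dens_le1.
Qed.

HB.instance Definition _ :=
  Measure_isSigmaFinite.Build _ _ _ lorentz_measure lorentz_measure_sigma_finite.

End hyperboloid_measure.
Arguments lorentz_measure : clear implicits.

Section functional.
Context {R : realType} {n : nat}.
Local Notation Hn := (hyperboloid R n).
Local Notation nu := (lorentz_measure R n).

(* Takes the value +oo when the product is essentially unbounded. *)
Definition sup_functional (p : R) (F G : Hn -> R) : \bar R :=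
  ess_sup (nu \x nu)%E (fun z : Hn * Hn =>
    (F z.1 * G z.2 *
     `|minkowski_form (hval z.1) (hval z.2) - 1| `^ (n%:R / p))%:E).

(* [Lfun] and the norm 'N[nu]_p are meaningful for all p > 0, including p < 1. *)
Definition hls_inequality (p : R) (E : R) : Prop :=
  forall F G : Hn -> R,
    (forall q, 0 <= F q) -> (forall q, 0 <= G q) ->
    F \in Lfun nu p%:E -> G \in Lfun nu p%:E ->
    ('N[nu]_p%:E[EFin \o F] * 'N[nu]_p%:E[EFin \o G]
      <= E%:E * sup_functional p F G)%E.

Definition extremal (p : R) (q : Hn) : R := `|(hval q).2| `^ (- (n%:R / p)).

End functional.

(* Main.v *)
From HB Require Import structures.
Require Import Defs.
From mathcomp Require Import all_boot all_order all_algebra.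
From mathcomp Require Import all_classical all_reals all_analysis.
From mathcomp Require Import measurable_realfun ess_sup_inf.
From mathcomp Require Import ring lra.
Import Order.TTheory GRing.Theory Num.Theory.
Import numFieldNormedType.Exports.

(** Write the integrals in terms of u = F^p and v = G^p. In dimension n the claim
is that u(q) v(t) |qt - 1|^n <= M for almost all (q, t) implies
2^n (int u dnu) (int v dnu) <= M I^2, where I is the integral of |q_(n+1)|^(-n).
The exponent p is gone, and the whole problem is invariant under O(1, n).

Transfer to R^n. Put s = 1 / (q_1 + q_(n+1)) and y = (s, s q_2, ..., s q_n),
which are the horospherical (half-space) coordinates, the two sheets being the
two half-spaces s > 0 and s < 0. In these coordinates dnu = |s|^(-n) dy
[lorentz_measure_horo] and |qt - 1| = |y - y'|^2 / (2 |s s'|)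
[minkowski_form_horo_point]. So U = u |s|^(-n) and V = v |s|^(-n) satisfy
U(y) V(y') |y - y'|^(2n) <= K, with K = 2^n M, for almost all y, y' in R^n, and it
remains to bound (int U)(int V) for Lebesgue measure; the function |q_(n+1)|^(-n) becomes
the density (2 / (1 + |y|^2))^n of the sphere in stereographic coordinates.

The inequality on R^n [euclidean_sup_inequality]. If A = {U >= s} and
B = {V >= t}, then A and B have mutual distances at most r = (K / (s t))^(1/(2n)),
that is, A - B lies in a ball of radius r; by the Brunn-Minkowski inequality the
radii of the balls with the volumes of A and B add up to at most r. Hence the
decreasing rearrangements of U and V, as functions of the radii rho and sigma,
satisfy U*(rho) V*(sigma) (rho + sigma)^(2n) <= K. With rho = e^(a/n) and
sigma = e^(b/n), the functions f(a) = e^a U*(rho) and g(b) = e^b V*(sigma), whose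
integrals are those of U and V up to the volume of the unit ball, satisfy
f(a) g(b) <= K k((a - b)/2)^2 with k(c) = (2 cosh(c/n))^(-n). After the reflection
b -> -b this is the hypothesis of the one-dimensional Prekopa-Leindler
inequality with weight 1/2, and the conclusion is (int U)(int V) <= K (int k)^2,
up to the same constants. When U is the spherical density, f is a multiple of k,
so int k can be compared with I [profile_le_spherical_density].

The Brunn-Minkowski inequality is itself deduced from Prekopa-Leindler in R^n,
which is proved by induction on n from the one-dimensional case. The hypothesis
holds only almost everywhere; it is reduced to one valid everywhere by choosing
a countable dense subset of the set of good points
[essential_brunn_minkowski_ball].

Sharpness. For F and G multiples of H(q) = |q_(n+1)|^(-n/p) the Cauchy-Schwarz
inequality gives |qt - 1| <= 2 |q_(n+1)| |t_(n+1)| [minkowski_form_le]. This bounds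
the right-hand side of the inequality by its left-hand side, so both are equal. *)

Set Implicit Arguments.
Unset Strict Implicit.
Unset Printing Implicit Defensive.

Local Open Scope classical_set_scope.
Local Open Scope ring_scope.

(** * Change of variables and iterated integrals *)

Section density.
Local Open Scope ereal_scope.
Context d1 d2 (X : measurableType d1) (Y : measurableType d2) (R : realType).
Import HBNNSimple.

(** The general change of variables: knowing mu on sets determines integrals, by
approximation with simple functions. All the substitutions below, including the
one on the hyperboloid, are instances. *)
Lemma ge0_integral_pushforward_density (phi : X -> Y) (w : X -> R)
    (lam : {measure set X -> \bar R}) (mu : {measure set Y -> \bar R})
    (f : Y -> \bar R) :
  measurable_fun setT phi -> measurable_fun setT w -> (forall x, (0 <= w x)%R) ->
  (forall A, measurable A -> mu A = \int[lam]_(x in phi @^-1` A) (w x)%:E) ->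
  measurable_fun setT f -> (forall y, 0 <= f y) ->
  \int[mu]_y f y = \int[lam]_x (f (phi x) * (w x)%:E).
Proof.
move=> mphi mw w0 muE mf f0.
pose g := nnsfun_approx measurableT mf.
have gf y : EFin \o g ^~ y @ \oo --> f y.
  by apply: cvg_nnsfun_approx => // *.
have ndg y m n : (m <= n)%N -> ((g m y)%:E <= (g n y)%:E).
  by move=> mn; rewrite lee_fin; exact/lefP/nd_nnsfun_approx.
transitivity (limn (fun n => \int[mu]_y (g n y)%:E)).
  rewrite -monotone_convergence//.
  - by apply: eq_integral => y _; apply/esym/cvg_lim => //; exact: gf.
  - by move=> n; exact/measurable_EFinP/measurable_funP.
  - by move=> n y _; rewrite lee_fin.
  - by move=> y _ m n; exact: ndg.
rewrite [X in limn X](_ : _ =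
    (fun n => \int[lam]_x ((g n (phi x))%:E * (w x)%:E))).
  rewrite -monotone_convergence//.
  - apply: eq_integral => x _; apply/cvg_lim => //.
    by apply: cvgeZr => //; exact: gf.
  - move=> n; apply/measurable_EFinP => /=; apply: measurable_funM => //.
    exact: measurableT_comp.
  - by move=> n x _; rewrite mule_ge0// lee_fin.
  - by move=> x _ m n mn; rewrite lee_wpmul2r ?lee_fin// -lee_fin ndg.
apply/funext => n.
transitivity (\sum_(k \in range (g n))
    \int[mu]_x (k * \1_(g n @^-1` [set k]) x)%:E).
  under eq_integral do rewrite fimfunE -fsumEFin//.
  rewrite ge0_integral_fsum//.
  - by move=> y; exact/measurable_EFinP/measurable_funM.
  - by move=> y x _; rewrite nnfun_muleindic_ge0.
transitivity (\sum_(k \in range (g n))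
    \int[lam]_x (k * \1_(g n @^-1` [set k]) (phi x) * w x)%:E).
  apply: eq_fsbigr => r /set_mem rg.
  have r0 : (0 <= r)%R by case: rg => y _ <-.
  rewrite integralZl_indic_nnsfun// integral_indic// setIT muE//.
  rewrite integral_mkcond.
  transitivity (\int[lam]_x (r%:E * (\1_(g n @^-1` [set r]) (phi x) * w x)%:E)).
    rewrite ge0_integralZl_EFin//.
    + congr (_ * _); apply: eq_integral => x _.
      rewrite patchE indicE; have [h|h] := pselect (g n (phi x) = r).
        by rewrite !mem_set// mul1r.
      by rewrite !memNset// mul0r.
    + by move=> x _; rewrite lee_fin mulr_ge0// indicE.
    + apply/measurable_EFinP/measurable_funM => //.
      exact: (measurableT_comp (measurable_indic _)).
  by apply: eq_integral => x _; rewrite -EFinM mulrA.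
rewrite -ge0_integral_fsum//.
- apply: eq_integral => x _; rewrite fsumEFin// [in RHS]fimfunE.
  by rewrite -EFinM; congr EFin; rewrite -mulr_fsuml.
- move=> r; apply/measurable_EFinP/measurable_funM => //.
  apply: measurable_funM => //.
  exact: (measurableT_comp (measurable_indic _)).
- move=> r x _; rewrite EFinM mule_ge0 ?lee_fin//.
  by have := nnfun_muleindic_ge0 (g n) r (phi x).
Qed.

End density.

Section lebesgue_basics.
Local Open Scope ereal_scope.
Context {R : realType}.

(** Transports the uniqueness of Lebesgue measure from the sigma-algebra generated by
the intervals to the Borel structure carried by R itself. *)
Lemma lebesgueR_unique (mu : {measure set R -> \bar R}) :
  (forall a b : R, (a <= b)%R -> mu `]a, b]%classic = (b - a)%:E) ->
  forall A, measurable A -> mu A = @lebesgueR R A.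
Proof.
move=> muE A mA.
pose m : set (measurableTypeR R) -> \bar R := mu.
have m0 : m set0 = 0 by exact: (measure0 mu).
have m_ge0 X : 0 <= m X by exact: (measure_ge0 mu).
have mS : semi_sigma_additive m by exact: (@measure_semi_sigma_additive _ _ _ mu).
pose M := isMeasure.Build _ (measurableTypeR R) R m m0 m_ge0 mS.
pose mm : {measure set (measurableTypeR R) -> \bar R} := HB.pack m M.
apply/esym; apply: (@lebesgue_measure_unique R mm) => // _ [[a b]] _ <-/=.
rewrite lebesgue_measure_itv/= lte_fin; case: ltP => ab.
  by apply/esym/muE; rewrite ltW.
by rewrite set_itv_ge ?measure0// bnd_simp -leNgt.
Qed.

Lemma ge0_integral_lebesgueR (D : set R) (f : R -> \bar R) :
  measurable D -> measurable_fun D f -> (forall x, D x -> 0 <= f x) ->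
  \int[@lebesgueR R]_(x in D) f x = \int[@lebesgue_measure R]_(x in D) f x.
Proof.
move=> mD mf f0.
have mid : measurable_fun setT (idfun : measurableTypeR R -> R).
  by move=> _ Y mY; rewrite setTI.
transitivity (\int[pushforward (@lebesgue_measure R)
    (idfun : measurableTypeR R -> R)]_(x in D) f x).
  by apply: eq_measure_integral.
by rewrite ge0_integral_pushforward// => x /set_mem; exact: f0.
Qed.

(** Tonelli for the inductive definition of Lebesgue measure; every statement on R^n is
proved from the line by splitting off the first coordinate. *)
Lemma ge0_integral_lebesgueRnS n (f : n.+1.-tuple R -> \bar R) :
  measurable_fun setT f -> (forall y, 0 <= f y) ->
  \int[lebesgueRn R n.+1]_y f y =
  \int[@lebesgueR R]_x \int[lebesgueRn R n]_t f [tuple of x :: t].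
Proof.
move=> mf f0 /=.
have mc : measurable_fun setT (@cons_pair _ R n) by exact: measurable_cons_pair.
transitivity (\int[pushforward (@lebesgueR R \x lebesgueRn R n) cons_pair]_y f y).
  by apply: eq_measure_integral.
rewrite ge0_integral_pushforward//.
rewrite preimage_setT fubini_tonelli1//; first exact: measurableT_comp.
by move=> x; exact: f0.
Qed.

Lemma measurable_cons_tuple n :
  measurable_fun setT (fun z : R * n.-tuple R => [tuple of z.1 :: z.2]).
Proof. exact: measurable_cons_pair. Qed.

Lemma measurable_consr n (x : R) :
  measurable_fun setT (fun t : n.-tuple R => [tuple of x :: t]).
Proof.
by apply: measurable_cons.
Qed.

Lemma measurable_integral_cons n (f : n.+1.-tuple R -> \bar R) :
  measurable_fun setT f -> (forall y, 0 <= f y) ->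
  measurable_fun setT (fun x => \int[lebesgueRn R n]_t f [tuple of x :: t]).
Proof.
move=> mf f0.
apply: (@measurable_fun_fubini_tonelli_F _ _ _ _ _ (lebesgueRn R n)
  (fun z => f [tuple of z.1 :: z.2])) => //.
by apply: measurableT_comp => //; exact: measurable_cons_tuple.
Qed.

(** A substitution on the line only has to be checked on half-open intervals, where it
is the fundamental theorem of calculus. *)
Lemma lebesgueR_substitution (phi w : R -> R) :
  measurable_fun setT phi -> measurable_fun setT w -> (forall x, 0 <= w x)%R ->
  (forall a b, (a <= b)%R ->
    \int[@lebesgueR R]_(x in phi @^-1` `]a, b]%classic) (w x)%:E = (b - a)%:E) ->
  forall f : R -> \bar R, measurable_fun setT f -> (forall x, 0 <= f x) ->
  \int[@lebesgueR R]_x f x = \int[@lebesgueR R]_x (f (phi x) * (w x)%:E).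
Proof.
move=> mphi mw w0 wE f mf f0.
apply: ge0_integral_pushforward_density => // A mA.
have mpre B : measurable B -> measurable (phi @^-1` B).
  by move=> mB; rewrite -[X in measurable X]setTI; exact: mphi.
pose m B := \int[@lebesgueR R]_(x in phi @^-1` B) (w x)%:E.
have m0 : m set0 = 0 by rewrite /m preimage_set0 integral_set0.
have m_ge0 B : 0 <= m B by apply: integral_ge0 => x _; rewrite lee_fin.
have mS : semi_sigma_additive m.
  move=> F mF tF mUF; rewrite /m preimage_bigcup.
  apply: (@semi_sigma_additive_nng_induced _ _ _ (@lebesgueR R)).
  - exact/measurable_EFinP.
  - by move=> x; rewrite lee_fin.
  - by move=> k; exact: mpre.
  - apply/trivIsetP => /= i j _ _ ij; rewrite -preimage_setI.
    by move/trivIsetP : tF => /(_ _ _ _ _ ij) ->//; rewrite preimage_set0.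
  - by rewrite -preimage_bigcup; apply: mpre.
pose mm : {measure set R -> \bar R} :=
  HB.pack m (isMeasure.Build _ R R m m0 m_ge0 mS).
exact: (esym (@lebesgueR_unique mm wE A mA)).
Qed.

Lemma lebesgueR_itv (a b : R) (x y : bool) : (a <= b)%R ->
  (@lebesgueR R : {measure set R -> \bar R}) [set` Interval (BSide x a) (BSide y b)] = (b - a)%:E.
Proof.
move=> ab; rewrite /= /lebesgueR lebesgue_measure_itv/= lte_fin.
case: ltP => // ba; suff -> : a = b by rewrite subrr.
by apply/eqP; rewrite eq_le ab.
Qed.

Lemma ge0_integral_lebesgueR_scale (c : R) (f : R -> \bar R) : c != 0%R ->
  measurable_fun setT f -> (forall x, 0 <= f x) ->
  \int[@lebesgueR R]_x f x = `|c|%:E * \int[@lebesgueR R]_x f (c * x)%R.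
Proof.
move=> c0 mf f0.
have mc : measurable_fun setT (fun x : R => (c * x)%R) by exact: mulrl_measurable.
rewrite (@lebesgueR_substitution (fun x => c * x)%R (fun=> `|c|%R))//.
- under eq_integral do rewrite muleC.
  by rewrite ge0_integralZl_EFin//; exact: measurableT_comp.
- move=> a b ab.
  have mpre : measurable ((fun x : R => c * x)%R @^-1` `]a, b]%classic).
    by rewrite -[X in measurable X]setTI; exact: mc.
  rewrite integral_cst//.
  have [c_gt0|c_lt0|/eqP] := ltgtP 0%R c; last by rewrite eq_sym (negbTE c0).
  + rewrite (_ : _ @^-1` _ = `](a / c)%R, (b / c)%R]%classic).
      rewrite lebesgueR_itv ?ler_pM2r ?invr_gt0// gtr0_norm// -EFinM.
      by rewrite mulrBr !mulrA ![(c * _)%R]mulrC !mulfK.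
    apply/seteqP; split => x /=; rewrite !in_itv/=;
      by rewrite ler_pdivlMr// ltr_pdivrMr// ![(x * _)%R]mulrC.
  + rewrite (_ : _ @^-1` _ = `[(b / c)%R, (a / c)%R[%classic).
      rewrite lebesgueR_itv ?ler_nM2r ?invr_lt0// ltr0_norm// -EFinM.
      rewrite mulrBr !mulNr !mulrA ![(c * _)%R]mulrC !mulfK//.
      by rewrite opprK addrC.
    apply/seteqP; split => x /=; rewrite !in_itv/=;
      by rewrite ler_ndivrMr// ltr_ndivlMr// ![(x * _)%R]mulrC andbC.
Qed.

End lebesgue_basics.

(** * Scaling and translation of Lebesgue measure *)

Section scaling.
Local Open Scope ereal_scope.
Context {R : realType}.

Definition lincomb n (a b : R) (x y : n.-tuple R) : n.-tuple R :=
  [tuple (a * tnth x i + b * tnth y i)%R | i < n].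

Definition scale_tuple n (c : R) (y : n.-tuple R) : n.-tuple R :=
  [tuple (c * tnth y i)%R | i < n].

Lemma lincomb_cons n a b (x0 y0 : R) (x y : n.-tuple R) :
  lincomb a b [tuple of x0 :: x] [tuple of y0 :: y] =
  [tuple of (a * x0 + b * y0)%R :: lincomb a b x y].
Proof.
apply: eq_from_tnth => i; rewrite tnth_mktuple.
by case: (unliftP ord0 i) => [j|] ->; rewrite ?tnth0// !tnthS tnth_mktuple.
Qed.

Lemma scale_tuple_cons n (c x : R) (t : n.-tuple R) :
  scale_tuple c [tuple of x :: t] = [tuple of (c * x)%R :: scale_tuple c t].
Proof.
apply: eq_from_tnth => i; rewrite tnth_mktuple.
by case: (unliftP ord0 i) => [j|] ->; rewrite ?tnth0// !tnthS tnth_mktuple.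
Qed.

Lemma measurable_scale_tuple n (c : R) : measurable_fun setT (@scale_tuple n c).
Proof.
apply/measurable_fun_tnthP => i.
rewrite (_ : _ \o _ = fun y : n.-tuple R => (c * tnth y i)%R).
  by apply: measurable_funM => //; exact: measurable_tnth.
by apply/funext => y /=; rewrite tnth_mktuple.
Qed.

Lemma ge0_integral_lebesgueRn_scale n (c : R) (f : n.-tuple R -> \bar R) :
  c != 0%R -> measurable_fun setT f -> (forall y, 0 <= f y) ->
  \int[lebesgueRn R n]_y f y =
  (`|c| ^+ n)%:E * \int[lebesgueRn R n]_y f (scale_tuple c y).
Proof.
move=> c0; elim: n f => [|n IH] f mf f0.
  rewrite expr0 mul1e; apply: eq_integral => y _.
  by rewrite [scale_tuple c y]tuple0 [y]tuple0.
rewrite ge0_integral_lebesgueRnS// (ge0_integral_lebesgueR_scale c0); last 2 first.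
- exact: measurable_integral_cons.
- by move=> x; exact: integral_ge0.
rewrite ge0_integral_lebesgueRnS//; last first.
  by apply: measurableT_comp => //; exact: measurable_scale_tuple.
under eq_integral => x _.
  rewrite IH//; last by apply: measurableT_comp => //; exact: measurable_consr.
  over.
rewrite ge0_integralZl_EFin//.
- rewrite muleA -EFinM -exprS; congr (_ * _); apply: eq_integral => x _.
  by apply: eq_integral => t _; rewrite scale_tuple_cons.
- by move=> x _; exact: integral_ge0.
- have mg : measurable_fun setT (fun y => f (scale_tuple c y)).
    by apply: measurableT_comp => //; exact: measurable_scale_tuple.
  have := measurable_integral_cons mg (fun y => f0 _).
  apply: eq_measurable_fun => x _.
  by apply: eq_integral => t _; rewrite scale_tuple_cons.
Qed.

Lemma lebesgueRn_scale n (c : R) (A : set (n.-tuple R)) : c != 0%R ->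
  measurable A ->
  lebesgueRn R n (scale_tuple c @^-1` A) = ((`|c| ^+ n)^-1)%:E * lebesgueRn R n A.
Proof.
move=> c0 mA.
have mS : measurable (scale_tuple c @^-1` A).
  by rewrite -[X in measurable X]setTI; exact: measurable_scale_tuple.
have := @ge0_integral_lebesgueRn_scale n c (EFin \o \1_A) c0.
rewrite integral_indic// setIT => -> //; last 2 first.
  exact/measurable_EFinP.
  by move=> y; rewrite lee_fin.
rewrite (_ : \int[_]_y _ = lebesgueRn R n (scale_tuple c @^-1` A)).
  by rewrite muleA -EFinM mulVf ?mul1e// expf_eq0 normr_eq0 (negbTE c0) andbF.
by rewrite -[X in _ = _ X]setIT -integral_indic//.
Qed.

Lemma ge0_integral_lebesgueR_shift (c : R) (f : R -> \bar R) :
  measurable_fun setT f -> (forall x, 0 <= f x) ->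
  \int[@lebesgueR R]_x f x = \int[@lebesgueR R]_x f (x + c)%R.
Proof.
move=> mf f0.
have mc : measurable_fun setT (fun x : R => (x + c)%R) by exact: measurable_funD.
rewrite (@lebesgueR_substitution _ (fun x => x + c)%R (fun=> 1%R))//.
  by apply: eq_integral => x _; rewrite mule1.
move=> a b ab.
have mpre : measurable ((fun x : R => x + c)%R @^-1` `]a, b]%classic).
  by rewrite -[X in measurable X]setTI; exact: mc.
rewrite integral_cst// mul1e (_ : _ @^-1` _ = `](a - c)%R, (b - c)%R]%classic).
  by rewrite lebesgueR_itv ?lerD2r// opprB addrA subrK.
by apply/seteqP; split => x /=; rewrite !in_itv/= lerBrDr ltrBlDr.
Qed.

Lemma lebesgueR_shift (c : R) (A : set R) : measurable A ->
  (@lebesgueR R : {measure set R -> \bar R}) ((fun x => x + c)%R @^-1` A) =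
  (@lebesgueR R : {measure set R -> \bar R}) A.
Proof.
move=> mA.
have mS : measurable ((fun x => x + c)%R @^-1` A).
  by rewrite -[X in measurable X]setTI; apply: measurable_funD.
have := @ge0_integral_lebesgueR_shift c (EFin \o \1_A).
rewrite integral_indic// setIT => -> //; last 2 first.
  exact/measurable_EFinP.
  by move=> y; rewrite lee_fin.
by rewrite -[X in _ X = _]setIT -integral_indic//.
Qed.

Lemma lebesgueR_scale (c : R) (A : set R) : c != 0%R -> measurable A ->
  (@lebesgueR R : {measure set R -> \bar R}) ((fun x => c * x)%R @^-1` A) =
  (`|c|^-1)%:E * (@lebesgueR R : {measure set R -> \bar R}) A.
Proof.
move=> c0 mA.
have mS : measurable ((fun x => c * x)%R @^-1` A).
  by rewrite -[X in measurable X]setTI; apply: mulrl_measurable.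
have := @ge0_integral_lebesgueR_scale R c (EFin \o \1_A) c0.
rewrite integral_indic// setIT => -> //; last 2 first.
  exact/measurable_EFinP.
  by move=> y; rewrite lee_fin.
rewrite (_ : \int[_]_y _ =
  (@lebesgueR R : {measure set R -> \bar R}) ((fun x => c * x)%R @^-1` A)).
  by rewrite muleA -EFinM mulVf ?mul1e// normr_eq0.
by rewrite -[X in _ = _ X]setIT -integral_indic//.
Qed.

End scaling.

(** * The Brunn-Minkowski inequality on the line *)

Section brunn_minkowski_1d.
Local Open Scope ereal_scope.
Context {R : realType}.
Local Notation leb := (@lebesgueR R : {measure set R -> \bar R}).

(** Turns a bound on sums into one that mentions only strict real lower bounds, so that
infinite measures need no separate treatment. *)
Lemma lee_adde_real (X Z Y : \bar R) : 0 <= X -> 0 <= Z -> 0 <= Y ->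
  (forall p q : R, p%:E < X -> q%:E < Z -> (p + q)%:E <= Y) -> X + Z <= Y.
Proof.
case: Y => [y||]//; last by move=> *; rewrite leey.
case: X => [x||]//; case: Z => [z||]// X0 Z0 Y0 h.
- rewrite -EFinD lee_fin; apply/ler_addgt0Pr => e e0.
  have := h (x - e / 2)%R (z - e / 2)%R.
  rewrite !lte_fin !ltrBlDr !ltrDl !divr_gt0// lee_fin => /(_ isT isT); lra.
- have := h (x - 1)%R (y + 2 - x)%R.
  rewrite lte_fin ltrBlDr ltrDl ltr01 ltry => /(_ isT isT).
  by rewrite lee_fin => ?; have : (1 <= 0 :> R)%R; [lra|rewrite ler10].
- have := h (y + 2 - z)%R (z - 1)%R.
  rewrite lte_fin ltrBlDr ltrDl ltr01 ltry => /(_ isT isT).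
  by rewrite lee_fin => ?; have : (1 <= 0 :> R)%R; [lra|rewrite ler10].
- have := h (y + 1)%R 0%R; rewrite !ltry => /(_ isT isT).
  by rewrite lee_fin => ?; have : (1 <= 0 :> R)%R; [lra|rewrite ler10].
Qed.

Lemma measure_bigcup_gt d (T : measurableType d) (mu : {measure set T -> \bar R})
    (F : (set T)^nat) (p : \bar R) :
  (forall k, measurable (F k)) -> nondecreasing_seq F ->
  p < mu (\bigcup_k F k) -> exists k, p < mu (F k).
Proof.
move=> mF ndF; apply: contraPP => /forallNP h; apply/negP; rewrite -leNgt.
have cF := nondecreasing_cvg_mu (mu := mu) mF (bigcup_measurable (fun k _ => mF k)) ndF.
rewrite -(cvg_lim _ cF)//; apply: lime_le; first by apply/cvg_ex; eexists; exact: cF.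
by apply: nearW => k /=; rewrite leNgt; apply/negP/h.
Qed.

Lemma lebesgueR_set1 (a : R) : leb [set a] = 0.
Proof. by rewrite /= /lebesgueR lebesgue_measure_set1. Qed.

(** The part of A to the left of a tends to A in measure as a increases to sup A inside A.
This replaces the usual reduction to compact sets, where a would be max A. *)
Lemma exists_lebesgueR_gt (A : set R) (p : R) : measurable A -> A !=set0 ->
  p%:E < leb A -> exists2 a, A a & p%:E < leb (A `&` `]-oo, a]%classic).
Proof.
move=> mA A0 pA; have [[M AM]|/forallNP nA] := pselect (has_ubound A).
- have [As|nAs] := pselect (A (sup A)).
    exists (sup A) => //; rewrite setIidl// => x Ax; rewrite /= in_itv/=.
    by apply: ub_le_sup => //; exists M.
  have hs : has_sup A by split=> //; exists M.
  have [||/=|k] := @measure_bigcup_gt _ _ leb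
    (fun k => A `&` `]-oo, (sup A - k.+1%:R^-1)%R]%classic) p%:E.
  + by move=> k; exact: measurableI.
  + move=> i j ij; apply/subsetPset => x /= [Ax]; rewrite !in_itv/= => h; split=> //.
    by apply: le_trans h _; rewrite lerB// lef_pV2 ?posrE ?ltr0n// ler_nat ltnS.
  + rewrite -setI_bigcupr setIidl// => x Ax.
    have xs : (x < sup A)%R.
      rewrite lt_neqAle (ub_le_sup hs.2 Ax) andbT.
      by apply: contra_not_neq nAs => <-.
    have [k _ kx] := near_infty_natSinv_lt (PosNum (eqbRL (subr_gt0 x (sup A)) xs)).
    exists k => //=; rewrite in_itv/= lerBrDr -lerBrDl.
    exact/ltW/(kx k)/leqnn.
  + have k0 : (0 < k.+1%:R^-1 :> R)%R by rewrite invr_gt0.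
    move=> pk; have [a Aa ak] := sup_adherent k0 hs.
    exists a => //; apply: lt_le_trans pk _; apply: le_measure.
    * by rewrite inE; exact: measurableI.
    * by rewrite inE; exact: measurableI.
    * apply: setIS; apply: subset_itvl; rewrite bnd_simp; exact/ltW/ak.
- have [||/=|k] := @measure_bigcup_gt _ _ leb
    (fun k => A `&` `]-oo, (k%:R)%R]%classic) p%:E.
  + by move=> k; exact: measurableI.
  + move=> i j ij; apply/subsetPset => x /= [Ax]; rewrite !in_itv/= => h; split=> //.
    by apply: le_trans h _; rewrite ler_nat.
  + rewrite -setI_bigcupr setIidl// => x Ax.
    exists (Num.truncn `|x|).+1 => //=; rewrite in_itv/= (le_trans (ler_norm _))//.
    exact/ltW/truncnS_gt.
  + move=> pk; have /existsNP[a /not_implyP[Aa /negP]] := nA k%:R.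
    rewrite -ltNge => ka; exists a => //; apply: lt_le_trans pk _; apply: le_measure.
    * by rewrite inE; exact: measurableI.
    * by rewrite inE; exact: measurableI.
    * by apply: setIS; apply: subset_itvl; rewrite bnd_simp; exact/ltW/ka.
Qed.
Lemma exists_lebesgueR_lt (B : set R) (q : R) : measurable B -> B !=set0 ->
  q%:E < leb B -> exists2 b, B b & q%:E < leb (B `&` `]b, +oo[%classic).
Proof.
move=> mB [b0 Bb0] qB; pose N := fun x : R => ((- 1) * x)%R.
have NN x : N (N x) = x by rewrite /N !mulN1r opprK.
have mN C : measurable C -> measurable (N @^-1` C).
  by move=> mC; rewrite -[X in measurable X]setTI; apply: mulrl_measurable.
have lN C : measurable C -> leb (N @^-1` C) = leb C.
  by move=> mC; rewrite lebesgueR_scale// ?oppr_eq0// normrN normr1 invr1 mul1e.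
have [||/=|a NBa] := @exists_lebesgueR_gt (N @^-1` B) q.
- exact: mN.
- by exists (N b0); rewrite /preimage/= NN.
- by rewrite [ltRHS]lN.
- rewrite (_ : _ `&` _ = N @^-1` (B `&` `[N a, +oo[%classic)); last first.
    apply/seteqP; split => x /=; rewrite !in_itv/= andbT => -[Bx h]; split => //.
      by rewrite /N !mulN1r lerN2.
    by move: h; rewrite /N !mulN1r lerN2.
  rewrite [ltRHS]lN; last exact: measurableI.
  move=> qNa; exists (N a) => //; apply: lt_le_trans qNa _.
  rewrite -[leRHS](measureU0 (B := [set N a])) ?lebesgueR_set1//; last exact: measurableI.
  apply: le_measure; rewrite ?inE.
  + exact: measurableI.
  + by apply: measurableU => //; exact: measurableI.
  + move=> x [Bx] /=; rewrite !in_itv/= !andbT le_eqVlt => /predU1P[->|]; first by right.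
    by left.
Qed.

(** For a in A and b in B, the set A + B contains the translate by b of the part of A to
the left of a and the translate by a of the part of B to the right of b; these are
separated by the point a + b. The bound follows as a and b exhaust A and B. *)
Lemma brunn_minkowski_1d_sum (A B C : set R) :
  measurable A -> measurable B -> measurable C -> A !=set0 -> B !=set0 ->
  (forall a b, A a -> B b -> C (a + b)%R) -> leb A + leb B <= leb C.
Proof.
move=> mA mB mC A0 B0 ABC; apply: lee_adde_real => // p q pA qB.
have [a Aa pa] := exists_lebesgueR_gt mA A0 pA.
have [b Bb qb] := exists_lebesgueR_lt mB B0 qB.
pose A' := A `&` `]-oo, a]%classic; pose B' := B `&` `]b, +oo[%classic.
have mA' : measurable A' by exact: measurableI.
have mB' : measurable B' by exact: measurableI.
pose A'' := (fun x => x + - b)%R @^-1` A'; pose B'' := (fun x => x + - a)%R @^-1` B'.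
have mA'' : measurable A''.
  by rewrite /A'' -[X in measurable X]setTI; apply: measurable_funD.
have mB'' : measurable B''.
  by rewrite /B'' -[X in measurable X]setTI; apply: measurable_funD.
apply: (@le_trans _ _ (leb A' + leb B')).
  by rewrite EFinD; apply: leeD; exact: ltW.
rewrite -(lebesgueR_shift (- b) mA') -(lebesgueR_shift (- a) mB') -/A'' -/B''.
rewrite -measureU//.
  apply: le_measure; rewrite ?inE//; first exact: measurableU.
  move=> x [[Ax _]|[Bx _]].
  - by rewrite -(subrK b x); exact: ABC.
  - by rewrite -(subrK a x) addrC; exact: ABC.
apply/seteqP; split => // x [[_]] /=; rewrite /= in_itv/= => h1 [_] /=.
rewrite in_itv/= andbT ltrBrDr => h2; move: h1; rewrite lerBlDr => h1.
by have := lt_le_trans h2 h1; rewrite addrC ltxx.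
Qed.

Lemma brunn_minkowski_1d (l : R) (A B C : set R) : (0 < l < 1)%R ->
  measurable A -> measurable B -> measurable C -> A !=set0 -> B !=set0 ->
  (forall a b, A a -> B b -> C ((1 - l) * a + l * b)%R) ->
  (1 - l)%:E * leb A + l%:E * leb B <= leb C.
Proof.
move=> /andP[l0 l1] mA mB mC [a0 Aa0] [b0 Bb0] ABC.
have scaleE c D : (0 < c)%R -> measurable D ->
    c%:E * leb D = leb ((fun x => c^-1 * x)%R @^-1` D).
  move=> c0 mD; rewrite lebesgueR_scale ?gtr0_norm ?invr_gt0// ?invrK//.
  by rewrite gt_eqF// invr_gt0.
have mS c D : measurable D -> measurable ((fun x : R => c^-1 * x)%R @^-1` D).
  by move=> mD; rewrite -[X in measurable X]setTI; apply: mulrl_measurable.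
have l1' : (0 < 1 - l)%R by rewrite subr_gt0.
rewrite !scaleE//; apply: brunn_minkowski_1d_sum => //; [exact: mS|exact: mS| | |].
- by exists ((1 - l) * a0)%R; rewrite /preimage/= mulKf// gt_eqF.
- by exists (l * b0)%R; rewrite /preimage/= mulKf// gt_eqF.
- move=> a b /= Aa Bb; have := ABC _ _ Aa Bb.
  by rewrite !mulVKf// gt_eqF.
Qed.

End brunn_minkowski_1d.

(** * Layer cake formulas *)

Section layer_cake.
Local Open Scope ereal_scope.
Context {R : realType} d (T : measurableType d).
Variable mu : {sigma_finite_measure set T -> \bar R}.
Local Notation leb := (@lebesgueR R : {measure set R -> \bar R}).

Lemma measurable_superlevel (f : T -> \bar R) (c : \bar R) : measurable_fun setT f ->
  measurable [set x | c <= f x].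
Proof.
by move=> mf; rewrite -[X in measurable X]setTI; exact: measurable_lee.
Qed.

Lemma tonelli_superlevel (f : T -> \bar R) (J : set R) :
  measurable_fun setT f -> measurable J ->
  \int[leb]_(t in J) mu [set x | t%:E <= f x] =
  \int[mu]_x leb (J `&` [set t | t%:E <= f x]).
Proof.
move=> mf mJ.
pose E := [set z : T * R | J z.2] `&` [set z : T * R | z.2%:E <= f z.1].
have mE : measurable E.
  apply: measurableI; rewrite -[X in measurable X]setTI.
    exact: measurable_snd.
  apply: measurable_lee => //; last exact: measurableT_comp.
  exact/measurable_EFinP.
have := @indic_fubini_tonelli _ _ _ _ R mu (@lebesgueR R) E mE.
rewrite indic_fubini_tonelli_FE// indic_fubini_tonelli_GE// => h.
rewrite [RHS](_ : _ = \int[mu]_x leb (xsection E x)); last first.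
  apply: eq_integral => x _; congr (leb _).
  by apply/seteqP; split => t; rewrite /xsection/= inE.
rewrite integral_mkcond [RHS]h; apply: eq_integral => t _.
rewrite patchE /=; case: ifPn => [/set_mem|/negP] Jt.
  congr (mu _); apply/seteqP; split => x; rewrite /ysection/= inE//.
  by case.
rewrite (_ : ysection E t = set0) ?measure0//.
by apply/seteqP; split => // x; rewrite /ysection/= inE => -[/mem_set].
Qed.

Lemma measurable_measure_superlevel (f : T -> \bar R) : measurable_fun setT f ->
  measurable_fun setT (fun t : R => mu [set x | t%:E <= f x]).
Proof.
move=> mf; pose E := [set z : T * R | z.2%:E <= f z.1].
have mE : measurable E.
  rewrite -[X in measurable X]setTI.
  apply: measurable_lee => //; last exact: measurableT_comp.
  exact/measurable_EFinP.
have := measurable_fun_ysection mu mE.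
apply: eq_measurable_fun => t _ /=; congr (mu _).
by apply/seteqP; split => x; rewrite /ysection/= inE.
Qed.

Lemma lebesgueR_itv01_superlevel (y : \bar R) : 0 <= y ->
  leb (`]0%R, 1%R[%classic `&` [set t | t%:E <= y]) = mine 1 y.
Proof.
case: y => [r||]//.
- rewrite lee_fin => r0; have [r1|r1] := leP 1%R r.
    rewrite setIidl.
      by rewrite lebesgueR_itv// subr0 min_l// lee_fin.
    move=> t /=; rewrite in_itv/= lee_fin => /andP[_ /ltW t1].
    exact: le_trans t1 r1.
  rewrite (_ : _ `&` _ = `]0%R, r]%classic).
    by rewrite lebesgueR_itv// subr0 min_r// lee_fin ltW.
  apply/seteqP; split => t /=; rewrite !in_itv/= lee_fin.
    by move=> [/andP[->]].
  by move=> /andP[-> tr]; split => //; rewrite (le_lt_trans tr).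
- move=> _; rewrite setIidl; first by rewrite lebesgueR_itv// subr0 min_l// leey.
  by move=> t _ /=; rewrite leey.
Qed.

(** Rescaling the levels to the fixed interval (0, 1) lets the level sets of several
functions with different maxima be compared at the same parameter t. *)
Lemma truncated_layer_cake (f : T -> \bar R) (a : R) : (0 < a)%R ->
  measurable_fun setT f -> (forall x, 0 <= f x) ->
  a%:E * \int[leb]_(t in `]0%R, 1%R[) mu [set x | (a * t)%:E <= f x] =
  \int[mu]_x mine a%:E (f x).
Proof.
move=> a0 mf f0.
pose g x := a^-1%:E * f x.
have mg : measurable_fun setT g by exact: measurable_funeM.
have -> : \int[leb]_(t in `]0%R, 1%R[) mu [set x | (a * t)%:E <= f x] =
    \int[leb]_(t in `]0%R, 1%R[) mu [set x | t%:E <= g x].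
  apply: eq_integral => t _; congr (mu _); apply/seteqP; split => x /=;
  by rewrite EFinM -lee_pdivlMl.
rewrite tonelli_superlevel// -ge0_integralZl//.
- apply: eq_integral => x _; have gx0 : 0 <= g x.
    by rewrite mule_ge0// lee_fin invr_ge0 ltW.
  rewrite lebesgueR_itv01_superlevel// mine_pMr ?lee_fin ?ltW//.
  by rewrite mule1 muleA -EFinM mulfV ?gt_eqF// mul1e.
- have : measurable_fun setT (fun x => mine 1 (g x)) by exact: measurable_mine.
  by apply: eq_measurable_fun => x _; rewrite lebesgueR_itv01_superlevel// mule_ge0// lee_fin invr_ge0 ltW.
- by rewrite lee_fin ltW.
Qed.

End layer_cake.

(** * The Prekopa-Leindler inequality *)

Section prekopa_leindler.
Local Open Scope ereal_scope.
Context {R : realType}.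
Local Notation leb := (@lebesgueR R : {measure set R -> \bar R}).

Definition geom_mean (l s t : R) : R := (s `^ (1 - l) * t `^ l)%R.

Lemma geom_mean_ge0 (l s t : R) : (0 <= geom_mean l s t)%R.
Proof. by rewrite mulr_ge0// powR_ge0. Qed.

Lemma geom_mean_gt0 (l s t : R) : (0 < s)%R -> (0 < t)%R -> (0 < geom_mean l s t)%R.
Proof. by move=> s0 t0; rewrite mulr_gt0// powR_gt0. Qed.

Lemma geom_mean_id (l c : R) : (0 < c)%R -> geom_mean l c c = c.
Proof.
move=> c0; rewrite /geom_mean -powRD; last by rewrite (gt_eqF c0) implybT.
by rewrite subrK powRr1// ltW.
Qed.

Lemma geom_meanM (l s t s' t' : R) : (0 <= s)%R -> (0 <= t)%R -> (0 <= s')%R ->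
  (0 <= t')%R ->
  geom_mean l (s * s')%R (t * t')%R = (geom_mean l s t * geom_mean l s' t')%R.
Proof. by move=> *; rewrite /geom_mean !powRM// mulrACA. Qed.

(** Weighted arithmetic-geometric mean inequality, from ln x <= x - 1. *)
Lemma geom_mean_le_arith (l s t : R) : (0 < l < 1)%R -> (0 < s)%R -> (0 < t)%R ->
  (geom_mean l s t <= (1 - l) * s + l * t)%R.
Proof.
move=> /andP[l0 l1] s0 t0; set m := ((1 - l) * s + l * t)%R.
have l1' : (0 < 1 - l)%R by rewrite subr_gt0.
have m0 : (0 < m)%R by rewrite addr_gt0// mulr_gt0.
have lnle u : (0 < u)%R -> (ln (u / m) <= u / m - 1)%R.
  move=> u0; rewrite -[X in ln X](subrK 1%R) addrC le_ln1Dx//.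
  by rewrite ltrBrDl subrr divr_gt0.
have -> : geom_mean l s t = (m * geom_mean l (s / m) (t / m))%R.
  rewrite -{1}(geom_mean_id l m0) -geom_meanM ?divr_ge0 ?ltW//.
  by rewrite ![(m * _)%R]mulrC !divfK// gt_eqF.
rewrite ger_pMr// /geom_mean /powR !gt_eqF ?divr_gt0// -expRD -[leRHS]expR0 ler_expR.
apply: (@le_trans _ _ ((1 - l) * (s / m - 1) + l * (t / m - 1)))%R.
  by apply: lerD; rewrite ler_pM2l// lnle// divr_gt0.
have -> : ((1 - l) * (s / m - 1) + l * (t / m - 1) = m / m - 1)%R.
  by rewrite {3}/m; ring.
by rewrite divff ?subrr// gt_eqF.
Qed.

(** Quantifying over real lower bounds of P and Q avoids powers of infinite quantities,
and makes the conclusion of Prekopa-Leindler in dimension n literally its hypothesis in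
the induction step. *)
Definition geom_le (l : R) (P Q H : \bar R) := forall s t : R,
  (0 < s)%R -> (0 < t)%R -> s%:E <= P -> t%:E <= Q -> (geom_mean l s t)%:E <= H.

(** Truncating f at height a loses little of the integral, and all levels below a are
attained: take a = sup f when f is bounded, and a large integer otherwise.
Nonempty level sets are what Brunn-Minkowski on the line requires. *)
Lemma exists_truncation (f : R -> \bar R) (p : R) : (0 <= p)%R ->
  measurable_fun setT f -> (forall x, 0 <= f x) -> p%:E < \int[leb]_x f x ->
  exists a : R, [/\ (0 < a)%R, forall t, (0 < t < 1)%R -> exists x, (a * t)%:E <= f x
    & p%:E < \int[leb]_x mine a%:E (f x)].
Proof.
move=> p0 mf f0 pf.
have [[a0 ua]|/forallNP nb] := pselect (exists a : R, forall x, f x <= a%:E).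
- pose S := [set fine (f x) | x in [set: R]].
  have ff x : f x \is a fin_num by rewrite ge0_fin_numE// (le_lt_trans (ua x))// ltry.
  have hS : has_sup S.
    split; first by exists (fine (f 0%R)), 0%R.
    by exists a0 => _ [x _ <-]; rewrite -lee_fin fineK.
  have fS x : f x <= (sup S)%:E.
    by rewrite -(fineK (ff x)) lee_fin; apply: ub_le_sup; [exact: hS.2|exists x].
  exists (sup S).
  have fE : \int[leb]_x mine (sup S)%:E (f x) = \int[leb]_x f x.
    by apply: eq_integral => x _; rewrite min_r.
  have S0 : (0 < sup S)%R.
    rewrite ltNge; apply/negP => S0.
    move: pf; rewrite integral0_eq ?lte_fin ?ltNge ?p0// => x _.
    by apply/eqP; rewrite eq_le f0 andbT (le_trans (fS x))// lee_fin.
  split=> //; last by rewrite fE.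
  move=> t /andP[t0 t1]; have e0 : (0 < sup S - sup S * t)%R.
    by rewrite subr_gt0 gtr_pMr.
  have [_ [x _ <-]] := sup_adherent e0 hS; rewrite opprB addrC subrK => h.
  by exists x; rewrite -(fineK (ff x)) lee_fin ltW.
- have cvg : \int[leb]_x mine k.+1%:R%:E (f x) @[k --> \oo] --> \int[leb]_x f x.
    rewrite [X in _ --> X](_ : _ = \int[leb]_x limn (fun k => mine k.+1%:R%:E (f x))).
      apply: cvg_monotone_convergence => //.
      + by move=> k; exact: measurable_mine.
      + by move=> k x _; rewrite le_min lee_fin ler0n f0.
      + move=> x _ i j ij; rewrite le_min !ge_min lexx orbT andbT lee_fin ler_nat ltnS.
        by rewrite ij.
    apply: eq_integral => x _; apply/esym/cvg_lim => //.
    have := f0 x; case: (f x) => [r||]// r0.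
    + apply: cvg_near_cst; near=> k; apply/min_idPr; rewrite lee_fin.
      apply: (@le_trans _ _ k%:R)%R; last by rewrite ler_nat.
      by near: k; exact: nbhs_infty_ger.
    + rewrite (_ : (fun k => _) = (fun k => k.+1%:R%:E)); last first.
        by apply/funext => k; rewrite min_l// leey.
      apply/cvgeryP/cvgryPge => A; near=> k.
      apply: (@le_trans _ _ k%:R)%R; last by rewrite ler_nat.
      by near: k; exact: nbhs_infty_ger.
  have [k pk] : exists k, p%:E < \int[leb]_x mine k.+1%:R%:E (f x).
    move: pf; apply: contraPP => /forallNP h; apply/negP; rewrite -leNgt.
    rewrite -(cvg_lim _ cvg)//; apply: lime_le; first by apply/cvg_ex; eexists; exact: cvg.
    by apply: nearW => k /=; rewrite leNgt; apply/negP/h.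
  exists k.+1%:R; split => // t /andP[t0 t1].
  have /existsNP[x /negP] := nb (k.+1%:R * t)%R.
  by rewrite -ltNge => /ltW ?; exists x.
Unshelve. all: by end_near. Qed.

(** At height t in (0, 1), the level set of h at c t contains the combination of those of
f at a t and g at b t, where c is the geometric mean of the truncation heights a and b.
Brunn-Minkowski on the line, integration in t and the arithmetic-geometric mean
inequality give the result for any p and q strictly below the integrals. *)
Lemma prekopa_leindler_1d (l : R) (f g h : R -> \bar R) : (0 < l < 1)%R ->
  measurable_fun setT f -> measurable_fun setT g -> measurable_fun setT h ->
  (forall x, 0 <= f x) -> (forall x, 0 <= g x) -> (forall x, 0 <= h x) ->
  (forall x y, geom_le l (f x) (g y) (h ((1 - l) * x + l * y)%R)) ->
  geom_le l (\int[leb]_x f x) (\int[leb]_x g x) (\int[leb]_x h x).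
Proof.
move=> l01 mf mg mh f0 g0 h0 fgh p q p0 q0 pf qg.
have /andP[l0 l1] := l01.
have l1' : (0 < 1 - l)%R by rewrite subr_gt0.
apply/lee_mul01Pr; first by rewrite lee_fin geom_mean_ge0.
move=> r /andP[r0 r1].
(* The factor r < 1 makes the lower bounds strict; it is removed in the limit r -> 1. *)
have [||a [a0 fa]] := @exists_truncation f (r * p)%R _ mf f0.
- by rewrite mulr_ge0// ltW.
- by apply: lt_le_trans pf; rewrite lte_fin gtr_pMl.
have [||b [b0 gb]] := @exists_truncation g (r * q)%R _ mg g0.
- by rewrite mulr_ge0// ltW.
- by apply: lt_le_trans qg; rewrite lte_fin gtr_pMl.
rewrite -!truncated_layer_cake//.
set Y := \int[_]_(_ in _) _; set X := \int[_]_(_ in _) _ => bY aX.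
set c := geom_mean l a b.
have c0 : (0 < c)%R by exact: geom_mean_gt0.
apply: (@le_trans _ _ (\int[leb]_x mine c%:E (h x))); last first.
  apply: ge0_le_integral => //.
  - by move=> x _; rewrite le_min lee_fin ltW//= h0.
  - exact: measurable_mine.
  - by move=> x _; rewrite ge_min lexx orbT.
rewrite -truncated_layer_cake//.
apply: (@le_trans _ _ (c%:E * ((1 - l)%:E * X + l%:E * Y))); last first.
  rewrite lee_pmul2l ?lte_fin//.
  have mlev (u : R -> \bar R) k : measurable_fun setT u ->
      measurable_fun setT (fun t : R => leb [set x | (k * t)%:E <= u x]).
    move=> mu; apply: (measurableT_comp (measurable_measure_superlevel (@lebesgueR R) mu)).
    exact: mulrl_measurable.
  have intZ (u : R -> \bar R) k m : measurable_fun setT u -> (0 < m)%R ->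
      m%:E * \int[leb]_(t in `]0%R, 1%R[) leb [set x | (k * t)%:E <= u x] =
      \int[leb]_(t in `]0%R, 1%R[) (m%:E * leb [set x | (k * t)%:E <= u x]).
    move=> mu m0; rewrite ge0_integralZl//; last by rewrite lee_fin ltW.
    by apply: measurable_funTS; exact: mlev.
  rewrite /X /Y !intZ//.
  rewrite -ge0_integralD//; last 4 first.
  - by move=> t _; rewrite mule_ge0// lee_fin ltW.
  - by apply/measurable_funTS/measurable_funeM; exact: mlev.
  - by move=> t _; rewrite mule_ge0// lee_fin ltW.
  - by apply/measurable_funTS/measurable_funeM; exact: mlev.
  apply: ge0_le_integral => //.
  - by move=> t _; rewrite adde_ge0// mule_ge0// lee_fin ltW.
  - by apply/measurable_funTS/emeasurable_funD; apply: measurable_funeM; exact: mlev.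
  - by apply: measurable_funTS; exact: mlev.
  - move=> t; rewrite /= in_itv/= => t01; apply: brunn_minkowski_1d => //.
    + exact: measurable_superlevel.
    + exact: measurable_superlevel.
    + exact: measurable_superlevel.
    + exact: fa.
    + exact: gb.
    + have /andP[t0 _] := t01.
      move=> x y /= fx gy; have := fgh x y _ _ (mulr_gt0 a0 t0) (mulr_gt0 b0 t0) fx gy.
      by rewrite (@geom_meanM l a b t t) ?(ltW a0) ?(ltW b0) ?(ltW t0)// (geom_mean_id l t0).
have Xp : ((r * p) / a)%:E <= X.
  by rewrite mulrC EFinM lee_pdivrMl// ltW.
have Yq : ((r * q) / b)%:E <= Y.
  by rewrite mulrC EFinM lee_pdivrMl// ltW.
apply: (@le_trans _ _ (c%:E * ((1 - l)%:E * (r * p / a)%:E + l%:E * (r * q / b)%:E))).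
  rewrite (_ : c%:E * _ =
    (c * ((1 - l) * (r * p / a) + l * (r * q / b)))%R%:E)// -EFinM lee_fin.
  apply: (@le_trans _ _ (c * geom_mean l (r * p / a) (r * q / b)))%R.
    rewrite /c -geom_meanM; try by rewrite ?divr_ge0 ?mulr_ge0// ltW.
    rewrite [(a * _)%R]mulrC [(b * _)%R]mulrC !divfK ?gt_eqF//.
    by rewrite geom_meanM ?(ltW r0) ?(ltW p0) ?(ltW q0)// (geom_mean_id l r0).
  by rewrite ler_pM2l// geom_mean_le_arith// divr_gt0// mulr_gt0.
rewrite lee_pmul2l ?lte_fin//.
by apply: leeD; rewrite lee_pmul2l ?lte_fin.
Qed.

(** Integrating out all coordinates but the first gives, by induction, functions on the
line that satisfy the hypothesis of the one-dimensional inequality. *)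
Lemma prekopa_leindler n (l : R) (f g h : n.-tuple R -> \bar R) : (0 < l < 1)%R ->
  measurable_fun setT f -> measurable_fun setT g -> measurable_fun setT h ->
  (forall x, 0 <= f x) -> (forall x, 0 <= g x) -> (forall x, 0 <= h x) ->
  (forall x y, geom_le l (f x) (g y) (h (lincomb (1 - l) l x y))) ->
  geom_le l (\int[lebesgueRn R n]_x f x) (\int[lebesgueRn R n]_x g x)
            (\int[lebesgueRn R n]_x h x).
Proof.
move=> l01; elim: n f g h => [|n IH] f g h mf mg mh f0 g0 h0 fgh.
  rewrite /= !integral_dirac// !diracT !mul1e.
  have := fgh [tuple] [tuple].
  by rewrite [lincomb _ _ _ _]tuple0.
rewrite !ge0_integral_lebesgueRnS//; apply: prekopa_leindler_1d => //.
- exact: measurable_integral_cons.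
- exact: measurable_integral_cons.
- exact: measurable_integral_cons.
- by move=> x; exact: integral_ge0.
- by move=> x; exact: integral_ge0.
- by move=> x; exact: integral_ge0.
- move=> x y; apply: IH => //.
  + by apply: measurableT_comp => //; exact: measurable_consr.
  + by apply: measurableT_comp => //; exact: measurable_consr.
  + by apply: measurableT_comp => //; exact: measurable_consr.
  + by move=> s t; rewrite -lincomb_cons; exact: fgh.
Qed.

End prekopa_leindler.

(** * Balls, and Brunn-Minkowski for sets at bounded mutual distance *)

Section balls.
Local Open Scope ereal_scope.
Context {R : realType}.
Local Notation leb := (@lebesgueR R : {measure set R -> \bar R}).

Definition sqnorm n (y : n.-tuple R) : R := (\sum_(i < n) tnth y i ^+ 2)%R.

Definition sqdist n (x y : n.-tuple R) : R :=
  (\sum_(i < n) (tnth x i - tnth y i) ^+ 2)%R.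

Definition cball n (r : R) : set (n.-tuple R) := [set y | (sqnorm y <= r ^+ 2)%R].

Lemma sqnorm_ge0 n (y : n.-tuple R) : (0 <= sqnorm y)%R.
Proof. by apply: sumr_ge0 => i _; exact: sqr_ge0. Qed.

Lemma sqdist_ge0 n (x y : n.-tuple R) : (0 <= sqdist x y)%R.
Proof. by apply: sumr_ge0 => i _; exact: sqr_ge0. Qed.

Lemma sqnorm_scale n c (y : n.-tuple R) : sqnorm (scale_tuple c y) = (c ^+ 2 * sqnorm y)%R.
Proof.
by rewrite /sqnorm big_distrr/=; apply: eq_bigr => i _; rewrite tnth_mktuple exprMn.
Qed.

Lemma measurable_sqnorm n : measurable_fun setT (@sqnorm n).
Proof.
apply: measurable_sum => i; apply: measurable_funX; exact: measurable_tnth.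
Qed.

Lemma measurable_sqdistr n (x : n.-tuple R) : measurable_fun setT (sqdist x).
Proof.
apply: measurable_sum => i; apply: measurable_funX.
by apply: measurable_funB => //; exact: measurable_tnth.
Qed.

Lemma measurable_cball n r : measurable (@cball n r).
Proof.
rewrite -[X in measurable X]setTI; apply: measurable_fun_ler => //.
exact: measurable_sqnorm.
Qed.

Lemma lebesgueRnS n (A : set (n.+1.-tuple R)) : measurable A ->
  lebesgueRn R n.+1 A =
  \int[leb]_x lebesgueRn R n [set t : n.-tuple R | A [tuple of x :: t]].
Proof.
move=> mA; rewrite -[X in lebesgueRn R n.+1 X]setIT -integral_indic//.
rewrite (ge0_integral_lebesgueRnS (f := EFin \o \1_A)); last 2 first.
- exact/measurable_EFinP.
- by move=> y; rewrite lee_fin.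
apply: eq_integral => x _.
rewrite -[X in lebesgueRn R n X]setIT -integral_indic//.
rewrite -[X in measurable X]setTI; exact: (measurable_consr x measurableT mA).
Qed.

Lemma measurable_cube n (a : R) :
  measurable [set y : n.-tuple R | forall i, (`|tnth y i| <= a)%R].
Proof.
rewrite (_ : [set _ | _] = \bigcap_(i in [set: 'I_n])
    ((fun y => `|tnth y i|%R) @^-1` `]-oo, a])).
  apply: fin_bigcap_measurable => // i _.
  rewrite -[X in measurable X]setTI.
  have : measurable_fun setT (fun y : n.-tuple R => `|tnth y i|%R).
    by apply: measurableT_comp => //; exact: measurable_tnth.
  by apply.
apply/seteqP; split => y /= h.
  by move=> i _ /=; rewrite in_itv/= h.
by move=> i; have /(_ i I)/= := h; rewrite in_itv.
Qed.

(** Cubes inside and outside the unit ball show that its volume is positive and finite. *)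
Lemma lebesgueRn_cube n (a : R) : (0 <= a)%R ->
  lebesgueRn R n [set y : n.-tuple R | forall i, (`|tnth y i| <= a)%R] =
  ((2 * a) ^+ n)%:E.
Proof.
move=> a0; elim: n => [|n IH].
  rewrite expr0 (_ : [set _ | _] = setT); first by rewrite /= diracT.
  by apply/seteqP; split => // y _ [].
rewrite lebesgueRnS; last exact: measurable_cube.
rewrite (_ : (fun x => _) = (cst ((2 * a) ^+ n)%:E) \_ `[(- a)%R, a]%classic).
  rewrite -integral_mkcond integral_cst// lebesgueR_itv; last by lra.
  by rewrite -EFinM opprK -mulr2n -[X in (_ * X)%R]mulr_natl mulrC -exprS.
apply/funext => x; rewrite patchE; case: ifPn => [|].
  rewrite inE/= in_itv/= -ler_norml => xa; rewrite -IH; congr (lebesgueRn R n _).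
  apply/seteqP; split => t /= h i.
    by have := h (lift ord0 i); rewrite tnthS.
  by case: (unliftP ord0 i) => [j|] ->; rewrite ?tnth0// tnthS.
move=> xa; rewrite (_ : [set _ | _] = set0) ?measure0//.
apply/seteqP; split => // t /= /(_ ord0); rewrite tnth0 => h; move/negP: xa; apply.
by rewrite inE/= in_itv/= -ler_norml.
Qed.

Definition ball_volume n : R := fine (lebesgueRn R n (@cball n 1)).

Lemma ball_volumeE n : lebesgueRn R n (@cball n 1) = (ball_volume n)%:E.
Proof.
rewrite /ball_volume fineK// ge0_fin_numE//.
apply: (@le_lt_trans _ _ (lebesgueRn R n [set y | forall i, (`|tnth y i| <= 1)%R])).
  apply: le_measure; rewrite ?inE; [exact: measurable_cball|exact: measurable_cube|].
  move=> y; rewrite /cball/= expr1n => h i; rewrite -(@expr_le1 _ 2)// real_normK ?num_real//.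
  apply: le_trans h; rewrite /sqnorm (bigD1 i)//= lerDl.
  by apply: sumr_ge0 => j _; exact: sqr_ge0.
by rewrite lebesgueRn_cube// ltry.
Qed.

Lemma ball_volume_gt0 n : (0 < ball_volume n)%R.
Proof.
rewrite -lte_fin -ball_volumeE.
have a0 : (0 < n.+1%:R^-1 :> R)%R by rewrite invr_gt0.
apply: (@lt_le_trans _ _ (lebesgueRn R n [set y | forall i, (`|tnth y i| <= n.+1%:R^-1)%R])).
  by rewrite lebesgueRn_cube ?ltW// lte_fin exprn_gt0// mulr_gt0.
apply: le_measure; rewrite ?inE; [exact: measurable_cube|exact: measurable_cball|].
move=> y /= h; rewrite /cball/= expr1n.
apply: (@le_trans _ _ (\sum_(i < n) n.+1%:R^-1))%R.
  apply: ler_sum => i _; rewrite -real_normK ?num_real//.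
  apply: (@le_trans _ _ (n.+1%:R^-1 ^+ 2))%R.
    by rewrite ler_sqr ?nnegrE// ltW.
  by rewrite expr2 ger_pMr// invf_le1// ler1n.
by rewrite sumr_const card_ord -[leLHS]mulr_natl ler_pdivrMr// mul1r ler_nat.
Qed.

Lemma lebesgueRn_cball n (r : R) : (0 < r)%R ->
  lebesgueRn R n (@cball n r) = (r ^+ n * ball_volume n)%:E.
Proof.
move=> r0; have r1 : (r^-1 != 0)%R by rewrite invr_neq0// gt_eqF.
rewrite (_ : cball r = scale_tuple r^-1 @^-1` (@cball n 1)).
  rewrite lebesgueRn_scale//; last exact: measurable_cball.
  by rewrite ball_volumeE normfV gtr0_norm// exprVn invrK.
apply/seteqP; split => y; rewrite /cball/= sqnorm_scale expr1n exprVn ler_pdivrMl ?exprn_gt0// mulr1//.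
Qed.

Lemma sqnorm_lincombN n (a b : R) (x y : n.-tuple R) :
  sqnorm (lincomb a b x y) = sqdist (scale_tuple a x) (scale_tuple (- b) y).
Proof.
by apply: eq_bigr => i _; rewrite !tnth_mktuple mulNr opprK.
Qed.

(** The additive form of Brunn-Minkowski for A - B contained in a ball. It follows from
Prekopa-Leindler for the indicators of A / (1 - l), - B / l and the ball, with the
weight l = Q / (P + Q) for which both rescaled lower bounds become (P + Q)^n. *)
Lemma brunn_minkowski_ball n (A B : set (n.-tuple R)) (r P Q : R) :
  measurable A -> measurable B -> (0 < r)%R -> (0 < P)%R -> (0 < Q)%R ->
  (P ^+ n)%:E <= lebesgueRn R n A -> (Q ^+ n)%:E <= lebesgueRn R n B ->
  (forall x y, A x -> B y -> (sqdist x y <= r ^+ 2)%R) ->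
  ((P + Q) ^+ n <= r ^+ n * ball_volume n)%R.
Proof.
move=> mA mB r0 P0 Q0 PA QB AB.
have S0 : (0 < P + Q)%R by exact: addr_gt0.
pose l := (Q / (P + Q))%R.
have l1E : (1 - l = P / (P + Q))%R.
  by rewrite /l -[X in (X - _)%R](@divff _ (P + Q)%R) ?gt_eqF// -mulrBl addrK.
have l0 : (0 < l)%R by rewrite divr_gt0.
(* With this weight, P / (1 - l) = Q / l = P + Q. *)
have l1 : (0 < 1 - l)%R by rewrite l1E divr_gt0.
have lN0 : (- l != 0)%R by rewrite oppr_eq0 gt_eqF.
have mpre c C : measurable C -> measurable (@scale_tuple R n c @^-1` C).
  by move=> mC; rewrite -[X in measurable X]setTI; exact: measurable_scale_tuple.
rewrite -lee_fin -lebesgueRn_cball//.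
have intE (C : set (n.-tuple R)) : measurable C ->
    \int[lebesgueRn R n]_x (\1_C x)%:E = lebesgueRn R n C.
  by move=> mC; rewrite integral_indic// setIT.
have := @prekopa_leindler R n l
  (EFin \o \1_(scale_tuple (1 - l) @^-1` A)) (EFin \o \1_(scale_tuple (- l) @^-1` B))
  (EFin \o \1_(@cball n r)).
rewrite /comp !intE; [|exact: measurable_cball|exact: mpre|exact: mpre].
rewrite (lebesgueRn_scale (lt0r_neq0 l1) mA) (lebesgueRn_scale lN0 mB) normrN !gtr0_norm// => /(_ _ _ _ _ _ _ _ _
  ((P + Q) ^+ n)%R ((P + Q) ^+ n)%R).
rewrite geom_mean_id ?exprn_gt0//; apply => //.
- by rewrite l0 -subr_gt0.
- by apply/measurable_EFinP/measurable_indic; exact: mpre.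
- by apply/measurable_EFinP/measurable_indic; exact: mpre.
- by apply/measurable_EFinP/measurable_indic; exact: measurable_cball.
- move=> x y s t s0 t0; rewrite !lee_fin !indicE => sA tB.
  have Ax : A (scale_tuple (1 - l) x).
    by apply: contrapT => nA; move: sA; rewrite memNset// leNgt s0.
  have By : B (scale_tuple (- l) y).
    by apply: contrapT => nB; move: tB; rewrite memNset// leNgt t0.
  rewrite [X in (_ <= (nat_of_bool X)%:R)%R]mem_set; last first.
    by rewrite /cball/= sqnorm_lincombN; exact: AB.
  move: sA tB; rewrite !mem_set// => s1 t1.
  apply: le_trans (geom_mean_le_arith _ s0 t0) _; first by rewrite l0 -subr_gt0.
  rewrite -[leRHS](subrK l); apply: lerD; rewrite ger_pMr//.
- rewrite lee_pdivlMl ?exprn_gt0// -EFinM -exprMn l1E divfK ?gt_eqF//.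
- rewrite lee_pdivlMl ?exprn_gt0// -EFinM -exprMn /l divfK ?gt_eqF//.
Qed.

End balls.

(** * From almost every pair of points to every pair *)

Section essential_brunn_minkowski.
Local Open Scope ereal_scope.
Context {R : realType}.

(** Closedness of the condition |x - y| <= r in x, in the form needed for points of a
grid, by |a + b|^2 <= (1 + eta) |a|^2 + (1 + 1 / eta) |b|^2. *)
Lemma sqdist_approx n (x y : n.-tuple R) (r : R) : (0 < r)%R ->
  (forall k, exists2 d : n.-tuple R,
     forall i, (`|tnth x i - tnth d i| <= k.+1%:R^-1)%R & (sqdist d y <= r ^+ 2)%R) ->
  (sqdist x y <= r ^+ 2)%R.
Proof.
move=> r0 h; apply/ler_addgt0Pr => e e0.
(* Chosen so that eta r^2 = e / 2. *)
pose eta := (e / 2 / r ^+ 2)%R.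
have eta0 : (0 < eta)%R by rewrite !divr_gt0// exprn_gt0.
pose C := ((1 + eta^-1) * n%:R)%R.
have C0 : (0 <= C)%R by rewrite mulr_ge0// addr_ge0// invr_ge0 ltW.
pose k := Num.truncn (C / (e / 2)).
have Ck : (C / k.+1%:R <= e / 2)%R.
  rewrite ler_pdivrMr// -ler_pdivrMl; last by rewrite divr_gt0.
  by rewrite mulrC ltW// truncnS_gt.
have [d xd dy] := h k.
apply: (@le_trans _ _ (\sum_(i < n) ((1 + eta) * (tnth d i - tnth y i) ^+ 2 +
    (1 + eta^-1) * (tnth x i - tnth d i) ^+ 2)))%R.
  apply: ler_sum => i _; set a := (tnth d i - _)%R; set b := (tnth x i - tnth d i)%R.
  have -> : (tnth x i - tnth y i = a + b)%R by rewrite /a /b; ring.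
  rewrite -subr_ge0.
  have -> : ((1 + eta) * a ^+ 2 + (1 + eta^-1) * b ^+ 2 - (a + b) ^+ 2 =
     eta * (a - eta^-1 * b) ^+ 2)%R by field; rewrite gt_eqF.
  by rewrite mulr_ge0 ?sqr_ge0// ltW.
rewrite big_split/= -!big_distrr/= -/(sqdist d y).
have -> : (r ^+ 2 + e = (1 + eta) * r ^+ 2 + e / 2)%R.
  by rewrite mulrDl mul1r /eta divfK ?gt_eqF ?exprn_gt0// -addrA -splitr.
apply: lerD; first by rewrite ler_pM2l// addr_gt0.
apply: le_trans Ck; rewrite /C -mulrA ler_pM2l; last by rewrite addr_gt0// invr_gt0.
apply: (@le_trans _ _ (\sum_(i < n) k.+1%:R^-1))%R.
  apply: ler_sum => i _; rewrite -real_normK ?num_real//.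
  apply: (@le_trans _ _ (k.+1%:R^-1 ^+ 2))%R.
    by rewrite ler_sqr ?nnegrE// invr_ge0.
  by rewrite expr2 ger_pMr ?invr_gt0// invf_le1// ler1n.
by rewrite sumr_const card_ord -[leLHS]mulr_natl.
Qed.

(** Discard from A the null set of points x that are bad for too many y. Choosing one good
point in each cell of the grids of mesh 1 / (k + 1) gives a countable dense set of good
points; discard from B the countable union of the null sets bad for these. By density,
all remaining pairs satisfy the bound. *)
Lemma essential_brunn_minkowski_ball n (A B : set (n.-tuple R)) (r P Q : R) :
  measurable A -> measurable B -> (0 < r)%R -> (0 < P)%R -> (0 < Q)%R ->
  (P ^+ n)%:E <= lebesgueRn R n A -> (Q ^+ n)%:E <= lebesgueRn R n B ->
  {ae lebesgueRn R n, forall x, A x ->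
    {ae lebesgueRn R n, forall y, B y -> (sqdist x y <= r ^+ 2)%R}} ->
  ((P + Q) ^+ n <= r ^+ n * ball_volume n)%R.
Proof.
move=> mA mB r0 P0 Q0 PA QB [N [mN N0 AN]].
pose A' := A `\` N.
have mA' : measurable A' by exact: measurableD.
have setD_null (C M : set (n.-tuple R)) : measurable C -> measurable M ->
    lebesgueRn R n M = 0 -> lebesgueRn R n C = lebesgueRn R n (C `\` M).
  move=> mC mM M0; apply/eqP; rewrite eq_le; apply/andP; split; last first.
    by apply: le_measure; rewrite ?inE//; exact: measurableD.
  rewrite -[leRHS](measureU0 (B := M))//; last exact: measurableD.
  apply: le_measure; rewrite ?inE//.
    by apply: measurableU => //; exact: measurableD.
  by move=> x Cx; have [Mx|nMx] := pselect (M x); [right|left].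
rewrite (setD_null _ _ mA mN N0) -/A' in PA.
have [a0 A'a0] : A' !=set0.
  apply/set0P/negP => /eqP A'0; move: PA; rewrite A'0 measure0 lee_fin.
  by rewrite leNgt exprn_gt0.
pose I := (nat * n.-tuple int)%type.
(* The cell of index (k, j) consists of the x with floor ((k + 1) x_i) = j_i. *)
pose box (c : I) := A' `&` [set x | forall i, Num.floor (c.1.+1%:R * tnth x i) = tnth c.2 i].
(* On empty cells the default value is again a good point. *)
pose d (c : I) := xget a0 (box c).
have A'd c : A' (d c).
  rewrite /d; case: xgetP => [x -> []//|_]; exact: A'a0.
pose F c := B `&` [set y | (r ^+ 2 < sqdist (d c) y)%R].
have mF c : measurable (F c).
  apply: measurableI => //; rewrite -[X in measurable X]setTI.
  apply: measurable_fun_ltr => //; exact: measurable_sqdistr.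
have F0 c : lebesgueRn R n (F c) = 0.
  apply/negligibleP => //; have [Ad nNd] := A'd c.
  have : {ae lebesgueRn R n, forall y, B y -> (sqdist (d c) y <= r ^+ 2)%R}.
    by apply: contrapT => h; apply: nNd; apply: AN => /= h'; apply: h; exact: h'.
  apply: negligibleS => y [By /= ry] h.
  by have := h By; rewrite leNgt ry.
pose G k := if @unpickle I k is Some c then F c else set0.
have mG k : measurable (G k) by rewrite /G; case: unpickle.
have G0 : lebesgueRn R n (\bigcup_k G k) = 0.
  apply/negligibleP; first exact: bigcup_measurable.
  apply: negligible_bigcup => k; apply/negligibleP => //.
  rewrite /G; case: unpickle => [c|]; [exact: F0|exact: measure0].
have mUG : measurable (\bigcup_k G k) by exact: bigcup_measurable.
rewrite (setD_null _ _ mB mUG G0) in QB.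
apply: brunn_minkowski_ball PA QB _ => //; first exact: measurableD.
move=> x y A'x [By nGy]; apply: sqdist_approx => // k.
pose c : I := (k, [tuple Num.floor (k.+1%:R * tnth x i) | i < n]).
have [_ dx] : box c (d c).
  apply: xgetPex; exists x; split => // i /=; by rewrite tnth_mktuple.
exists (d c); last first.
  rewrite leNgt; apply/negP => rd; apply: nGy; exists (pickle c) => //.
  by rewrite /G pickleK.
move=> i; have := dx i; rewrite /c/= tnth_mktuple => fl.
rewrite -[leRHS]mul1r ler_pdivlMr// -[X in (_ * X)%R]gtr0_norm// -normrM mulrBl.
have := floor_itv (k.+1%:R * tnth x i)%R; have := floor_itv (k.+1%:R * tnth (d c) i)%R.
rewrite fl intrD ![(_%:R * tnth _ _)%R]mulrC => /andP[d1 d2] /andP[x1 x2].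
by rewrite ler_norml; apply/andP; split; lra.
Qed.

End essential_brunn_minkowski.

(** * The layer cake formula in an exponential coordinate *)

Section exponential_coordinate.
Local Open Scope ereal_scope.
Context {R : realType}.
Local Notation leb := (@lebesgueR R : {measure set R -> \bar R}).

Lemma integral_expR_itvNyc (L : R) :
  \int[leb]_(a in `]-oo, L]) (expR a)%:E = (expR L)%:E.
Proof.
have mE (f : R -> R) (D : set R) : measurable D -> measurable_fun setT f ->
    measurable_fun setT ((fun a => (expR (f a))%:E) \_ D).
  move=> mD mf; apply/(measurable_restrictT _ _).1 => //; apply/measurable_funTS.
  by apply/measurable_EFinP; apply: measurableT_comp.
have rE (f : R -> R) (D : set R) x : 0 <= ((fun a => (expR (f a))%:E) \_ D) x.
  by rewrite patchE; case: ifPn => // _; rewrite lee_fin expR_ge0.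
rewrite integral_mkcond (@ge0_integral_lebesgueR_scale _ (-1)%R) ?oppr_eq0//.
rewrite normrN normr1 mul1e (@ge0_integral_lebesgueR_shift _ (- L)%R); last 2 first.
- have := mE idfun `]-oo, L]%classic; move=> /(_ (measurable_itv _)).
  move=> /(_ (@measurable_id _ _ _)) m.
  by apply: (measurableT_comp m); exact: mulrl_measurable.
- by move=> x; exact: rE.
transitivity (\int[leb]_x ((expR L)%:E * (exponential_pdf 1 x)%:E)).
  apply: eq_integral => x _; rewrite !patchE /exponential_pdf patchE.
  have [x0|x0] := leP 0%R x.
    rewrite !mem_set/= ?in_itv/= ?x0//; last by lra.
    by rewrite mul1r -EFinM -expRD; congr (expR _)%:E; lra.
  by rewrite !memNset/= ?in_itv/= ?andbT ?mule0 => //; apply/negP; rewrite -ltNge; lra.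
- rewrite ge0_integralZl_EFin ?expR_ge0//.
  + rewrite ge0_integral_lebesgueR//.
    * by rewrite integral_exponential_pdf// mule1.
    * by apply/measurable_EFinP; exact: measurable_exponential_pdf.
    * by move=> x _; rewrite lee_fin exponential_pdf_ge0.
  + by move=> x _; rewrite lee_fin exponential_pdf_ge0.
  + by apply/measurable_EFinP; exact: measurable_exponential_pdf.
- by apply: (mE idfun) => //; exact: measurable_id.
Qed.

Lemma integral_exp_superlevel (w : R) (y : \bar R) : (0 < w)%R -> 0 <= y ->
  \int[leb]_a ((w * expR a)%:E * (\1_[set a : R | ((w * expR a)%:E <= y)%E] a)%:E) = y.
Proof.
move=> w0 y0.
have mexp : measurable_fun setT (fun a : R => (w * expR a)%R).
  by apply: measurable_funM => //; exact: measurable_expR.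
have mset z : measurable [set a : R | (w * expR a)%:E <= z].
  rewrite -[X in measurable X]setTI; apply: measurable_lee => //.
  exact/measurable_EFinP.
have fin (r : R) : (0 < r)%R ->
    \int[leb]_a ((w * expR a)%:E * (\1_[set a : R | ((w * expR a)%:E <= r%:E)%E] a)%:E) = r%:E.
  move=> r0; have rw0 : (0 < r / w)%R by rewrite divr_gt0.
  rewrite (_ : [set _ | _] = `]-oo, ln (r / w)]%classic).
    transitivity (w%:E * \int[leb]_(a in `]-oo, ln (r / w)]) (expR a)%:E).
      rewrite -ge0_integralZl_EFin ?ltW//.
      + rewrite [RHS]integral_mkcond; apply: eq_integral => a _.
        by rewrite patchE indicE; case: ifPn => _; rewrite ?mule1 ?mule0 ?EFinM.
      + by apply/measurable_EFinP/measurable_funTS; exact: measurable_expR.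
    by rewrite integral_expR_itvNyc -EFinM lnK ?posrE// mulrC divfK// gt_eqF.
  have E a : (w * expR a <= r)%R = (a <= ln (r / w))%R.
    by rewrite -[RHS]ler_expR lnK ?posrE// ler_pdivlMr// mulrC.
  by apply/seteqP; split => a /=; rewrite in_itv/= lee_fin E.
move: y0; case: y => [r||]//.
- rewrite lee_fin le_eqVlt => /predU1P[<-|]; last exact: fin.
  apply: integral0_eq => a _; rewrite indicE memNset ?mule0//=.
  by apply/negP; rewrite -ltNge lte_fin mulr_gt0// expR_gt0.
- move=> _; apply/eqyP => r r0; rewrite -[leLHS]fin//; apply: ge0_le_integral => //.
  + by move=> a _; rewrite -EFinM lee_fin mulr_ge0 ?mulr_ge0 ?expR_ge0// ltW.
  + apply: emeasurable_funM; first exact/measurable_EFinP.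
    by apply/measurable_EFinP; apply: measurable_indic.
  + apply: emeasurable_funM; first exact/measurable_EFinP.
    by apply/measurable_EFinP; apply: measurable_indic.
  + move=> a _; rewrite lee_pmul2l ?lte_fin ?mulr_gt0 ?expR_gt0//.
    rewrite lee_fin !indicE ler_nat; case: (_ \in _) => //.
    by rewrite mem_set//= leey.
Qed.

(** The layer cake formula in the variable a, the level being w e^a. It is obtained from
Tonelli and the integral of e^a over a half-line, so that no substitution in the
integral of a merely measurable function is involved. *)
Lemma exponential_layer_cake (w : R) (D : R -> \bar R) : (0 < w)%R ->
  measurable_fun setT D -> (forall t, 0 <= D t) ->
  \int[leb]_t D t =
  \int[leb]_a ((w * expR a)%:E * leb [set t | (w * expR a)%:E <= D t]).
Proof.
move=> w0 mD D0.
have mexp : measurable_fun setT (fun a : R => (w * expR a)%R).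
  by apply: measurable_funM => //; exact: measurable_expR.
pose E := [set z : R * R | (w * expR z.2)%:E <= D z.1].
have mE : measurable E.
  rewrite -[X in measurable X]setTI; apply: measurable_lee => //.
    by apply/measurable_EFinP; exact: (measurableT_comp mexp).
  exact: measurableT_comp.
have mset a : measurable [set t | (w * expR a)%:E <= D t].
  exact: measurable_superlevel.
transitivity (\int[leb]_t \int[leb]_a ((w * expR a)%:E * (\1_E (t, a))%:E)).
  apply: eq_integral => t _; rewrite -[LHS](integral_exp_superlevel w0 (D0 t)).
  by apply: eq_integral => a _; rewrite !indicE /E; congr (_ * ((_ : bool)%:R)%:E);
    apply/idP/idP; rewrite !inE.
rewrite (@fubini_tonelli _ _ _ _ R (@lebesgueR R) (@lebesgueR R)
  (fun z => (w * expR z.2)%:E * (\1_E z)%:E)); last 2 first.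
- apply: emeasurable_funM; apply/measurable_EFinP.
    exact: (measurableT_comp mexp).
  exact: measurable_indic.
- by move=> z; rewrite -EFinM lee_fin mulr_ge0 ?mulr_ge0 ?expR_ge0// ltW.
apply: eq_integral => a _.
rewrite /= ge0_integralZl_EFin ?mulr_ge0 ?expR_ge0 ?ltW//.
- congr (_ * _); rewrite -[X in leb X]setIT -integral_indic//.
- by apply/measurable_EFinP; apply: (measurableT_comp (measurable_indic _)).
Qed.

End exponential_coordinate.

(** * The inequality on Euclidean space *)

Section euclidean_inequality.
Local Open Scope ereal_scope.
Context {R : realType}.
Local Notation leb := (@lebesgueR R : {measure set R -> \bar R}).

(** This is ball_volume n * (2 cosh (c / n))^(-n). *)
Definition profile n (c : R) : R :=
  (ball_volume n * expR c / (1 + expR (2 * c / n%:R)) ^+ n)%R.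

Lemma profile_ge0 n c : (0 <= profile n c)%R.
Proof.
by rewrite /profile divr_ge0 ?mulr_ge0 ?expR_ge0//; exact/ltW/ball_volume_gt0.
Qed.

Lemma expR_div_natK n (c : R) : (0 < n)%N -> (expR (c / n%:R) ^+ n = expR c)%R.
Proof.
by move=> n0; rewrite -expRM_natl mulrC divfK// pnatr_eq0 -lt0n.
Qed.

(** The identity behind the choice of exponential coordinates: e^(a/n) + e^(b/n), the sum
of two radii, depends only on a - b up to the factor e^((a+b)/(2n)). *)
Lemma profile_midpoint n (a b : R) : (0 < n)%N ->
  (profile n ((a - b) / 2) ^+ 2 * (expR (a / n%:R) + expR (b / n%:R)) ^+ (2 * n) =
   ball_volume n ^+ 2 * expR (a + b))%R.
Proof.
move=> n0; have n1 : (n%:R != 0 :> R)%R by rewrite pnatr_eq0 -lt0n.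
have -> : (expR (a / n%:R) + expR (b / n%:R) =
    expR (b / n%:R) * (1 + expR ((a - b) / n%:R)))%R.
  by rewrite mulrDr mulr1 -expRD addrC; congr (_ + expR _)%R; field.
have -> (D : R) : ((expR (b / n%:R) * D) ^+ (2 * n) = expR b ^+ 2 * (D ^+ n) ^+ 2)%R.
  by rewrite exprMn mulnC !exprM expR_div_natK.
rewrite /profile.
have -> : (2 * ((a - b) / 2) / n%:R = (a - b) / n%:R)%R by field.
set D := (1 + _)%R; have D0 : (D != 0)%R by rewrite gt_eqF// addr_gt0// expR_gt0.
rewrite expr_div_n exprMn.
have -> : (expR (a + b) = expR ((a - b) / 2) ^+ 2 * expR b ^+ 2)%R.
  by rewrite -!expRM_natl -expRD; congr expR; field.
by field; rewrite expf_neq0.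
Qed.

Lemma measurable_profile n : measurable_fun setT (@profile n).
Proof.
rewrite (_ : @profile n = (fun c => ball_volume n * expR c *
    ((1 + expR (2 * c / n%:R)) ^+ n) `^ (-1))%R); last first.
  apply/funext => c; rewrite powR_inv1// exprn_ge0// addr_ge0// expR_ge0//.
apply: measurable_funM.
  by apply: measurable_funM => //; exact: measurable_expR.
apply: (measurableT_comp (@measurable_powR R (-1))).
apply: measurable_funX; apply: measurable_funD => //.
apply: (measurableT_comp (@measurable_expR R)).
by apply: measurable_funM => //; exact: mulrl_measurable.
Qed.

(** For two sets of positive numbers, |S| |T| <= sup S sup T. *)
Lemma lebesgueR_product_le (S T : set R) (K p q : R) :
  measurable S -> measurable T -> (0 < p)%R -> (0 < q)%R ->
  p%:E <= leb S -> q%:E <= leb T ->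
  (forall s, S s -> 0 < s)%R -> (forall t, T t -> 0 < t)%R ->
  (forall s t, S s -> T t -> s * t <= K)%R -> (p * q <= K)%R.
Proof.
move=> mS mT p0 q0 pS qT S0 T0 STK.
have slice (C : set R) (L r : R) : measurable C -> (0 < r)%R -> r%:E <= leb C ->
    (forall x, C x -> 0 < x <= L)%R -> (r <= L)%R.
  move=> mC r0 rC CL; have [x Cx] : C !=set0.
    apply/set0P/negP => /eqP C0; move: rC.
    by rewrite C0 measure0 lee_fin leNgt r0.
  have L0 : (0 <= L)%R by have /andP[x0 xL] := CL _ Cx; apply/ltW: (lt_le_trans x0 xL).
  rewrite -lee_fin (le_trans rC)// -[X in _ <= (X)%:E]subr0 -(lebesgueR_itv false false L0).
  by apply: le_measure; rewrite ?inE// => y /CL yL; rewrite /= in_itv/=.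
have H t : T t -> (p * t <= K)%R.
  move=> Tt; rewrite -ler_pdivlMr ?T0//; apply: (slice S) => // s Ss.
  by rewrite S0//= ler_pdivlMr ?T0// STK.
rewrite mulrC -ler_pdivlMr//; apply: (slice T) => // t Tt.
by rewrite T0//= ler_pdivlMr// mulrC H.
Qed.

Variables (n : nat) (n_gt0 : (0 < n)%N).
Local Notation mu := (lebesgueRn R n).

(** The Lebesgue measure of this set of levels is the decreasing rearrangement U* of U
evaluated at the volume w = ball_volume n * e^a, so this is w U*(w). *)
Definition distribution_profile (U : n.-tuple R -> R) (a : R) : \bar R :=
  (ball_volume n * expR a)%:E *
  leb [set t : R | (0 < t)%R /\
     (ball_volume n * expR a)%:E <= mu [set x | t%:E <= (U x)%:E]].

Let superE (U : n.-tuple R -> R) a :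
  [set t : R | (0 < t)%R /\
     (ball_volume n * expR a)%:E <= mu [set x | t%:E <= (U x)%:E]] =
  [set t | (ball_volume n * expR a)%:E <=
     ((fun t => mu [set x | t%:E <= (U x)%:E]) \_ `]0%R, +oo[%classic) t].
Proof.
have w0 : (0 < ball_volume n * expR a)%R.
  by rewrite mulr_gt0 ?expR_gt0// ball_volume_gt0.
apply/seteqP; split => t /=.
  by move=> [t0 h]; rewrite patchE mem_set//= in_itv/= t0.
rewrite patchE; case: ifPn => [|_].
  by rewrite inE/= in_itv/= andbT.
by rewrite leNgt lte_fin w0.
Qed.

Let mdist (U : n.-tuple R -> R) : measurable_fun setT U ->
  measurable_fun setT ((fun t => mu [set x | t%:E <= (U x)%:E]) \_ `]0%R, +oo[%classic).
Proof.
move=> mU; apply/(measurable_restrictT _ _).1 => //; apply/measurable_funTS.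
by apply: measurable_measure_superlevel; exact/measurable_EFinP.
Qed.

Lemma integral_distribution_profile (U : n.-tuple R -> R) :
  measurable_fun setT U -> (forall x, 0 <= U x)%R ->
  \int[mu]_x (U x)%:E = \int[leb]_a distribution_profile U a.
Proof.
move=> mU U0.
transitivity (\int[leb]_(t in `]0%R, +oo[) mu [set x | t%:E <= (U x)%:E]).
  rewrite (@tonelli_superlevel _ _ _ mu (EFin \o U))//; last exact/measurable_EFinP.
  apply: eq_integral => x _; rewrite (_ : _ `&` _ = `]0%R, U x]%classic).
    by rewrite lebesgueR_itv// subr0.
  apply/seteqP; split => t /=; rewrite !in_itv/= andbT lee_fin; first by move=> [-> ->].
  by move=> /andP[].
rewrite integral_mkcond [LHS](@exponential_layer_cake _ (ball_volume n)).
- by apply: eq_integral => a _; rewrite /distribution_profile superE.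
- exact: ball_volume_gt0.
- exact: mdist.
- by move=> t; rewrite patchE; case: ifPn.
Qed.

Lemma measurable_distribution_profile (U : n.-tuple R -> R) : measurable_fun setT U ->
  measurable_fun setT (distribution_profile U).
Proof.
move=> mU.
have mexp : measurable_fun setT (fun a : R => (ball_volume n * expR a)%R).
  by apply: measurable_funM => //; exact: measurable_expR.
apply: emeasurable_funM; first exact/measurable_EFinP.
under eq_fun do rewrite superE.
apply: (measurableT_comp (measurable_measure_superlevel (@lebesgueR R) (mdist mU))).
exact: mexp.
Qed.

(** The level sets of U and V have mutual distances at most (M / (s t))^(1/(2n)), and have
at least the volumes of balls of radii e^(a/n) and e^(b/n), so Brunn-Minkowski bounds
the sum of these radii. *)
Lemma superlevel_product_le (U V : n.-tuple R -> R) (M : R) : (0 < M)%R ->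
  measurable_fun setT U -> measurable_fun setT V ->
  (forall x, 0 <= U x)%R -> (forall x, 0 <= V x)%R ->
  {ae mu, forall x, {ae mu, forall y, (U x * V y * sqdist x y ^+ n <= M)%R}} ->
  forall a b s t : R, (0 < s)%R -> (0 < t)%R ->
  (ball_volume n * expR a)%:E <= mu [set x | s%:E <= (U x)%:E] ->
  (ball_volume n * expR b)%:E <= mu [set y | t%:E <= (V y)%:E] ->
  (s * t <= M / (expR (a / n%:R) + expR (b / n%:R)) ^+ (2 * n))%R.
Proof.
move=> M0 mU mV U0 V0 aeM a b s t s0 t0 aU bV.
have st0 : (0 < s * t)%R by rewrite mulr_gt0.
have w0 : (0 < @ball_volume R n)%R by exact: ball_volume_gt0.
(* The radii of the balls are e^(a/n) and e^(b/n), so P = root (ball_volume n) * e^(a/n). *)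
pose root (c : R) : R := (c `^ n%:R^-1)%R.
have rootK c : (0 <= c)%R -> (root c ^+ n = c)%R.
  by move=> c0; rewrite /root -powR_mulrn ?powR_ge0// -powRrM mulVf ?powRr1// pnatr_eq0 -lt0n.
pose L := (expR (a / n%:R) + expR (b / n%:R))%R.
have L0 : (0 < L)%R by rewrite addr_gt0// expR_gt0.
pose r := Num.sqrt (root (M / (s * t)))%R.
have r0 : (0 < r)%R by rewrite sqrtr_gt0 powR_gt0// divr_gt0.
have r2 : (r ^+ 2 = root (M / (s * t)))%R by rewrite sqr_sqrtr// powR_ge0.
have := @essential_brunn_minkowski_ball R n [set x | s%:E <= (U x)%:E]
  [set y | t%:E <= (V y)%:E] r (root (ball_volume n) * expR (a / n%:R))%R
  (root (ball_volume n) * expR (b / n%:R))%R.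
have rootM c : ((root (ball_volume n) * c) ^+ n = ball_volume n * c ^+ n)%R.
  by rewrite exprMn rootK// ltW.
rewrite -mulrDr -/L !rootM !expR_div_natK// [X in (_ <= X)%R]mulrC ler_pM2l// => H.
have {}H : (L ^+ n <= r ^+ n)%R.
  apply: H => //.
  - by apply: measurable_superlevel; exact/measurable_EFinP.
  - by apply: measurable_superlevel; exact/measurable_EFinP.
  - by rewrite mulr_gt0 ?powR_gt0 ?expR_gt0.
  - by rewrite mulr_gt0 ?powR_gt0 ?expR_gt0.
  - apply: filterS aeM => x hx; rewrite /= lee_fin => sU.
    apply: filterS hx => y hy; rewrite /= lee_fin => tV.
    rewrite r2 -(ler_pXn2r n_gt0) ?nnegrE ?sqdist_ge0 ?powR_ge0//.
    rewrite rootK; last by rewrite divr_ge0 ?ltW.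
    rewrite ler_pdivlMr// mulrC (le_trans _ hy)//.
    by rewrite ler_wpM2r ?exprn_ge0 ?sqdist_ge0// ler_pM// ltW.
rewrite ler_pdivlMr ?exprn_gt0// mulrC -ler_pdivlMr//.
rewrite -(rootK (M / (s * t))%R (ltW (divr_gt0 M0 st0))) -r2 exprM exprAC.
rewrite [leRHS]exprAC ler_pXn2r// nnegrE exprn_ge0// ltW//.
Qed.

(** Prekopa-Leindler with weight 1/2 for the profile of U and the reflected profile of V. *)
Lemma euclidean_sup_inequality (U V : n.-tuple R -> R) (M p q : R) : (0 < M)%R ->
  measurable_fun setT U -> measurable_fun setT V ->
  (forall x, 0 <= U x)%R -> (forall x, 0 <= V x)%R ->
  {ae mu, forall x, {ae mu, forall y, (U x * V y * sqdist x y ^+ n <= M)%R}} ->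
  (0 < p)%R -> (0 < q)%R ->
  p%:E <= \int[mu]_x (U x)%:E -> q%:E <= \int[mu]_x (V x)%:E ->
  (Num.sqrt (p * q))%:E <= (Num.sqrt M)%:E * \int[leb]_c (profile n c)%:E.
Proof.
move=> M0 mU mV U0 V0 aeM p0 q0; rewrite !integral_distribution_profile// => pU.
have mFU := measurable_distribution_profile mU.
have mFV := measurable_distribution_profile mV.
have F0 W a : 0 <= distribution_profile W a.
  by rewrite mule_ge0// lee_fin mulr_ge0 ?expR_ge0// ltW// ball_volume_gt0.
rewrite (@ge0_integral_lebesgueR_scale _ (-1)%R) ?oppr_eq0//.
rewrite normrN normr1 mul1e => qV.
have E (x y : R) : (0 < x)%R -> (0 < y)%R -> geom_mean 2^-1 x y = Num.sqrt (x * y).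
  move=> x0 y0; rewrite /geom_mean (_ : 1 - 2^-1 = 2^-1)%R; last by field.
  by rewrite -powRM ?ltW// powR12_sqrt// mulr_ge0// ltW.
rewrite -E// -ge0_integralZl_EFin ?sqrtr_ge0//; last 2 first.
  by move=> c _; rewrite lee_fin profile_ge0.
  by apply/measurable_EFinP; exact: measurable_profile.
apply: prekopa_leindler_1d p0 q0 pU qV.
- by apply/andP; split; lra.
- by [].
- by apply: (measurableT_comp mFV); exact: mulrl_measurable.
- by apply: measurable_funeM; apply/measurable_EFinP; exact: measurable_profile.
- exact: F0.
- by move=> b; exact: F0.
- by move=> c; rewrite mule_ge0// lee_fin ?sqrtr_ge0 ?profile_ge0.
move=> a b x y x0 y0; rewrite /distribution_profile => xS yT.
move: xS yT; set wa := (ball_volume n * expR a)%R; set wb := (ball_volume n * expR (-1 * b))%R.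
have w0 : (0 < @ball_volume R n)%R by exact: ball_volume_gt0.
have wa0 : (0 < wa)%R by rewrite mulr_gt0 ?expR_gt0.
have wb0 : (0 < wb)%R by rewrite mulr_gt0 ?expR_gt0.
move=> xS yT; rewrite -lee_pdivrMl// -EFinM in xS.
rewrite -lee_pdivrMl// -EFinM in yT.
pose L := (expR (a / n%:R) + expR ((-1 * b) / n%:R))%R.
have L0 : (0 < L)%R by rewrite addr_gt0// expR_gt0.
have H : (wa^-1 * x * (wb^-1 * y) <= M / L ^+ (2 * n))%R.
  apply: lebesgueR_product_le xS yT _ _ _.
  - rewrite superE; apply: measurable_superlevel; exact: mdist.
  - rewrite superE; apply: measurable_superlevel; exact: mdist.
  - by rewrite mulr_gt0 ?invr_gt0.
  - by rewrite mulr_gt0 ?invr_gt0.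
  - by move=> s [].
  - by move=> s [].
  - by move=> s t [s0 sU] [t0 tV]; apply: (superlevel_product_le (U := U) (V := V)).
rewrite E// -EFinM lee_fin -(ger0_norm (profile_ge0 n _)) -sqrtr_sqr -(sqrtrM _ (ltW M0)).
rewrite ler_wsqrtr//.
have -> : ((1 - 2^-1) * a + 2^-1 * b = (a - (-1 * b)) / 2)%R by field.
have L2 : (0 < L ^+ (2 * n))%R by rewrite exprn_gt0.
rewrite -(ler_pM2r L2) -[leRHS]mulrA profile_midpoint//.
move: H; rewrite ler_pdivlMr// => H.
have -> : (M * (ball_volume n ^+ 2 * expR (a + -1 * b)) = wa * wb * M)%R.
  by rewrite expRD /wa /wb; ring.
rewrite -(ler_pM2l (mulr_gt0 wa0 wb0)) in H; apply: (le_trans _ H); rewrite le_eqVlt; apply/orP; left.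
by apply/eqP; field; rewrite !gt_eqF.
Qed.

End euclidean_inequality.

(** * The horospherical substitution in one variable *)

Section horospherical_1d.
Local Open Scope ereal_scope.
Context {R : realType}.
Local Notation leb := (@lebesgueR R : {measure set R -> \bar R}).

Lemma measurable_fun_invr : measurable_fun setT (fun x : R => x^-1)%R.
Proof.
rewrite (_ : (fun _ => _) = (fun x => x * (x ^+ 2) `^ (-1))%R); last first.
  apply/funext => x; rewrite powR_inv1 ?sqr_ge0//.
  have [->|x0] := eqVneq x 0%R; first by rewrite invr0 mul0r.
  by field.
apply: measurable_funM => //.
by apply: (measurableT_comp (@measurable_powR R (-1))); exact: measurable_funX.
Qed.

(** The coordinate q_1 of the point of the hyperboloid with horospherical coordinate s,
where c = 1 + q_2^2 + ... + q_n^2: indeed q_(n+1) + q_1 = 1 / s and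
q_(n+1) - q_1 = c s. The same formula serves both sheets. *)
Definition horo (c s : R) : R := ((s^-1 - c * s) / 2)%R.

Lemma horoN c s : horo c (- s) = (- horo c s)%R.
Proof. by rewrite /horo invrN; ring. Qed.

Lemma measurable_horo c : measurable_fun setT (horo c).
Proof.
apply: measurable_funM => //; apply: measurable_funB => //.
exact: measurable_fun_invr.
Qed.

Lemma norm_lt_sqrt (c b : R) : (0 < c)%R -> (`|b| < Num.sqrt (b ^+ 2 + c))%R.
Proof.
move=> c0; rewrite -(ltr_pXn2r (_ : 0 < 2)%N) ?nnegrE ?sqrtr_ge0//.
by rewrite real_normK ?num_real// sqr_sqrtr ?ltrDl// addr_ge0 ?sqr_ge0// ltW.
Qed.

Lemma horo_root_gt0 (c b : R) : (0 < c)%R -> (0 < b + Num.sqrt (b ^+ 2 + c))%R.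
Proof.
move=> /(norm_lt_sqrt b); rewrite ltr_norml => /andP[h _].
by rewrite addrC -ltrBlDr sub0r ltrNl.
Qed.

(** Solves horo c s = b for s > 0: the positive root of c s^2 + 2 b s - 1 = 0. *)
Lemma horo_le (c s b : R) : (0 < c)%R -> (0 < s)%R ->
  (horo c s <= b)%R = ((b + Num.sqrt (b ^+ 2 + c))^-1 <= s)%R.
Proof.
move=> c0 s0; have := horo_root_gt0 b c0; have := norm_lt_sqrt b c0.
have : (Num.sqrt (b ^+ 2 + c) ^+ 2 = b ^+ 2 + c)%R.
  by rewrite sqr_sqrtr// addr_ge0 ?sqr_ge0// ltW.
set B := Num.sqrt _ => B2; rewrite ltr_norml => /andP[_ b2] bB0.
rewrite -[RHS](ler_pM2r bB0) mulVf ?gt_eqF// -[LHS]subr_ge0 -[RHS]subr_ge0.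
have sB : (0 < 1 + s * (B - b))%R by rewrite addr_gt0// mulr_gt0// subr_gt0.
have -> : (b - horo c s = (2 * s)^-1 * ((s * (b + B) - 1) * (1 + s * (B - b))))%R.
  have -> : c = (B ^+ 2 - b ^+ 2)%R by rewrite B2; ring.
  by rewrite /horo; field; rewrite gt_eqF.
by rewrite pmulr_rge0 ?pmulr_lge0// invr_gt0 mulr_gt0.
Qed.

Lemma horo_root (c b : R) : (0 < c)%R ->
  horo c (b + Num.sqrt (b ^+ 2 + c))^-1 = b.
Proof.
move=> c0; have := horo_root_gt0 b c0.
have : (Num.sqrt (b ^+ 2 + c) ^+ 2 = b ^+ 2 + c)%R.
  by rewrite sqr_sqrtr// addr_ge0 ?sqr_ge0// ltW.
set B := Num.sqrt _ => B2 bB.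
have -> : c = (B ^+ 2 - b ^+ 2)%R by rewrite B2; ring.
by rewrite /horo; field; rewrite gt_eqF.
Qed.

Lemma is_derive_horo (c s : R) : s != 0%R ->
  is_derive s 1%R (fun s : R => - horo c s)%R ((s ^- 2 + c) / 2)%R.
Proof.
move=> s0.
rewrite (_ : (fun _ => _) = (2^-1 *: (c *: (@id R) - (fun s => s^-1)))%R); last first.
  by apply/funext => t; rewrite /horo -mulNr opprB mulrC.
have dV := @is_deriveV R id s 1 1%R s0 (is_derive_id _ _).
apply: is_derive_eq.
by rewrite /GRing.scale/=; field.
Qed.

Lemma integral_horo_derivative (c x y : R) : (0 < x)%R -> (x < y)%R ->
  \int[@lebesgue_measure R]_(s in `[x, y]) ((s ^- 2 + c) / 2)%:E =
  (horo c x - horo c y)%:E.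
Proof.
move=> x0 xy.
have dF (s : R) : (0 < s)%R ->
    is_derive s 1%R (fun s : R => - horo c s)%R ((s ^- 2 + c) / 2)%R.
  by move=> s0; apply: is_derive_horo; rewrite gt_eqF.
have cF (s : R) : (0 < s)%R -> {for s, continuous (fun s : R => - horo c s)%R}.
  move=> s0; apply: differentiable_continuous; apply/derivable1_diffP.
  by have [] := dF s s0.
have cf (s : R) : (0 < s)%R -> {for s, continuous (fun s : R => (s ^- 2 + c) / 2)%R}.
  move=> s0; apply: continuousM; last exact: cst_continuous.
  apply: continuousD; last exact: cst_continuous.
  apply: continuousV; first by rewrite expf_eq0/= gt_eqF.
  exact: exprn_continuous.
rewrite (@continuous_FTC2 _ _ (fun s => - horo c s)%R)//.
- by rewrite -EFinB opprK addrC.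
- apply: continuous_in_subspaceT => s; rewrite inE/= in_itv/= => /andP[xs _].
  by apply: cf; exact: lt_le_trans xs.
- split.
  + by move=> s; rewrite in_itv/= => /andP[xs _]; have [] := dF s (lt_trans x0 xs).
  + by apply: cvg_at_right_filter; exact: cF.
  + by apply: cvg_at_left_filter; apply: cF; exact: lt_trans xy.
- move=> s; rewrite in_itv/= => /andP[xs _]; rewrite derive1E.
  by have [] := dF s (lt_trans x0 xs).
Qed.


Lemma measurable_pos_indic : measurable_fun setT (fun s : R => (0 < s)%R%:R : R).
Proof.
rewrite (_ : (fun _ => _) = \1_(`]0%R, +oo[%classic : set R)); first exact: measurable_indic.
apply/funext => s; rewrite indicE; congr (_%:R); congr nat_of_bool.
by apply/idP/idP; rewrite inE/= in_itv/= andbT.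
Qed.

Lemma measurable_invr_sqrt (c : R) :
  measurable_fun setT (fun z : R => (Num.sqrt (z ^+ 2 + c))^-1)%R.
Proof.
apply: (measurableT_comp measurable_fun_invr).
apply: (@measurableT_comp _ _ _ _ _ _ (@Num.sqrt R)).
  by apply: continuous_measurable_fun; exact: sqrt_continuous.
by apply: measurable_funD => //; exact: measurable_funX.
Qed.

(** With z = horo c s one has dz / sqrt (z^2 + c) = - ds / s. *)
Lemma horo_substitution (c : R) (F : R -> \bar R) : (0 < c)%R ->
  measurable_fun setT F -> (forall z, 0 <= F z) ->
  \int[leb]_z (F z * ((Num.sqrt (z ^+ 2 + c))^-1)%:E) =
  \int[leb]_s (F (horo c s) * (s^-1 * (0 < s)%R%:R)%:E).
Proof.
move=> c0 mF F0.
have mw : measurable_fun setT (fun s : R => (s ^- 2 + c) / 2 * (0 < s)%R%:R)%R.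
  apply: measurable_funM; last exact: measurable_pos_indic.
  apply: measurable_funM => //; apply: measurable_funD => //.
  by apply: (measurableT_comp measurable_fun_invr); exact: measurable_funX.
rewrite (@lebesgueR_substitution _ (horo c) (fun s => (s ^- 2 + c) / 2 * (0 < s)%R%:R)%R).
- apply: eq_integral => s _; rewrite -muleA -EFinM; congr (_ * (_)%:E).
  have [s0|] := ltP 0%R s; last by rewrite !mulr0.
  rewrite !mulr1.
  have d0 : (0 < (s^-1 + c * s) / 2)%R.
    by rewrite divr_gt0// addr_gt0 ?invr_gt0// mulr_gt0.
  have -> : (horo c s ^+ 2 + c = ((s^-1 + c * s) / 2) ^+ 2)%R.
    by rewrite /horo; field; rewrite gt_eqF.
  rewrite sqrtr_sqr gtr0_norm//; field.
  rewrite !gt_eqF ?addr_gt0 ?mulr_gt0 ?exprn_gt0//.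
- exact: measurable_horo.
- exact: mw.
- by move=> s; rewrite mulr_ge0// divr_ge0// addr_ge0 ?invr_ge0 ?sqr_ge0// ltW.
- move=> a b ab; pose r (u : R) := ((u + Num.sqrt (u ^+ 2 + c))^-1)%R.
  have r0 u : (0 < r u)%R by rewrite invr_gt0 horo_root_gt0.
  transitivity (\int[leb]_(s in `[r b, r a[) ((s ^- 2 + c) / 2)%:E).
    rewrite integral_mkcond [RHS]integral_mkcond; apply: eq_integral => s _.
    rewrite !patchE; have [s0|s0] := ltP 0%R s.
      rewrite mulr1; congr (if _ then _ else _).
      have E1 : (a < horo c s)%R = (s < r a)%R by rewrite ltNge horo_le// -ltNge.
      by apply/idP/idP; rewrite !inE/= !in_itv/= E1 horo_le// andbC.
    rewrite mulr0 if_same memNset//= in_itv/= => /andP[rs _].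
    by have := lt_le_trans (r0 b) rs; rewrite ltNge s0.
  have [ab'|ba] := ltP a b; last first.
    have -> : a = b by apply/eqP; rewrite eq_le ab.
    by rewrite subrr set_itv_ge ?integral_set0// bnd_simp ltxx.
  have rab : (r b < r a)%R.
    by rewrite ltNge -horo_le// horo_root// -ltNge.
  have mf D : measurable_fun D (fun s : R => ((s ^- 2 + c) / 2)%:E).
    apply/measurable_EFinP/measurable_funTS.
    apply: measurable_funM => //; apply: measurable_funD => //.
    by apply: (measurableT_comp measurable_fun_invr); exact: measurable_funX.
  rewrite ge0_integral_lebesgueR//; last first.
    by move=> s _; rewrite lee_fin divr_ge0// addr_ge0 ?invr_ge0 ?sqr_ge0// ltW.
  rewrite integral_itv_bndo_bndc// integral_horo_derivative//.
  by rewrite !horo_root.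
- apply: emeasurable_funM => //; apply/measurable_EFinP; exact: measurable_invr_sqrt.
- by move=> z; rewrite mule_ge0// lee_fin invr_ge0 sqrtr_ge0.
Qed.

(** The negative sheet b = true follows from the positive one by z -> - z and s -> - s. *)
Lemma horo_substitution_sheet (b : bool) (c : R) (F : R -> \bar R) : (0 < c)%R ->
  measurable_fun setT F -> (forall z, 0 <= F z) ->
  \int[leb]_z (F z * ((Num.sqrt (z ^+ 2 + c))^-1)%:E) =
  \int[leb]_s (F (horo c s) * (`|s|^-1 * (0 < (-1) ^+ b * s)%R%:R)%:E).
Proof.
move=> c0 mF F0.
have mw d : measurable_fun setT (fun s : R => (s^-1 * (0 < d * s)%R%:R)%R).
  apply: measurable_funM; first exact: measurable_fun_invr.
  by apply: (measurableT_comp measurable_pos_indic); exact: mulrl_measurable.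
case: b; last first.
  rewrite horo_substitution//; apply: eq_integral => s _.
  rewrite expr0 mul1r; case: ltP => s0; last by rewrite !mulr0.
  by rewrite gtr0_norm.
rewrite (@ge0_integral_lebesgueR_scale _ (-1)%R) ?oppr_eq0//; last 2 first.
- apply: emeasurable_funM => //; apply/measurable_EFinP; exact: measurable_invr_sqrt.
- by move=> z; rewrite mule_ge0// lee_fin invr_ge0 sqrtr_ge0.
rewrite normrN normr1 mul1e.
under eq_integral do rewrite exprMn sqrrN expr1n mul1r.
rewrite (horo_substitution (F := fun z => F (-1 * z)%R))//; last first.
  by apply: measurableT_comp => //; exact: mulrl_measurable.
rewrite (@ge0_integral_lebesgueR_scale _ (-1)%R) ?oppr_eq0//; last 2 first.
- apply: emeasurable_funM.
    apply: (measurableT_comp mF); apply: (measurableT_comp (mulrl_measurable _)).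
    exact: measurable_horo.
  by apply/measurable_EFinP; have := mw 1%R; under eq_fun do rewrite mul1r.
- move=> z; rewrite mule_ge0// lee_fin; case: ltP => z0; last by rewrite mulr0.
  by rewrite mulr1 invr_ge0 ltW.
rewrite normrN normr1 mul1e; apply: eq_integral => s _.
rewrite expr1 !mulN1r horoN opprK; congr (_ * (_)%:E).
case: ltP => s0; last by rewrite !mulr0.
by rewrite !mulr1 ltr0_norm// -oppr_gt0.
Qed.

End horospherical_1d.

(** * Horospherical coordinates on the hyperboloid *)

Section horospherical.
Local Open Scope ereal_scope.
Context {R : realType} {m : nat}.
Local Notation leb := (@lebesgueR R : {measure set R -> \bar R}).
Local Notation mu := (lebesgueRn R m).
Local Notation Hn := (hyperboloid R m.+1).

Definition horo_coord (s : R) (x : m.-tuple R) : m.+1.-tuple R :=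
  [tuple of horo (1 + sqnorm x) s :: x].

(** The point with horospherical coordinates y = (s, X): its coordinates q_2, ..., q_n are
X / s, and its sheet is given by the sign of s. For s = 0 the density below is
0, since the inverse of 0 is 0. *)
Definition horo_point (y : m.+1.-tuple R) : Hn :=
  sheet (thead y < 0)%R
    (horo_coord (thead y) (scale_tuple (thead y)^-1 [tuple of behead y])).

Definition horo_density (y : m.+1.-tuple R) : R := (`|thead y| ^- m.+1)%R.

Lemma measurable_thead : measurable_fun setT (fun y : m.+1.-tuple R => thead y).
Proof. exact: measurable_tnth. Qed.

Lemma measurable_horo_coord :
  measurable_fun setT (fun z : R * m.-tuple R => horo_coord z.1 z.2).
Proof.
apply: measurable_cons; last exact: measurable_snd.
apply: measurable_funM => //; apply: measurable_funB.
  exact: (measurableT_comp measurable_fun_invr).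
apply: measurable_funM => //; apply: measurable_funD => //.
exact: (measurableT_comp (@measurable_sqnorm R m)).
Qed.

Lemma measurable_scale_tuple2 :
  measurable_fun setT (fun z : R * m.-tuple R => scale_tuple z.1 z.2).
Proof.
apply/measurable_fun_tnthP => i.
rewrite (_ : _ \o _ = fun z : R * m.-tuple R => (z.1 * tnth z.2 i)%R).
  apply: measurable_funM => //.
  by apply: (measurableT_comp (measurable_tnth _)).
by apply/funext => y /=; rewrite tnth_mktuple.
Qed.

Lemma measurable_horo_point : measurable_fun setT horo_point.
Proof.
pose g (y : m.+1.-tuple R) :=
  horo_coord (thead y) (scale_tuple (thead y)^-1 [tuple of behead y]).
have mg : measurable_fun setT g.
  apply: (measurableT_comp measurable_horo_coord (g := fun y : m.+1.-tuple R =>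
     (thead y, scale_tuple (thead y)^-1 [tuple of behead y]))).
  apply: measurable_fun_pair; first exact: measurable_thead.
  apply: (measurableT_comp measurable_scale_tuple2 (g := fun y : m.+1.-tuple R =>
     ((thead y)^-1, [tuple of behead y])%R)).
  apply: measurable_fun_pair; last exact: measurable_behead.
  exact: (measurableT_comp measurable_fun_invr measurable_thead).
rewrite (_ : horo_point = fun y => if (thead y < 0)%R then sheet true (g y)
    else sheet false (g y)); last first.
  by apply/funext => y; rewrite /horo_point; case: ifP.
apply: measurable_fun_ifT.
- by apply: measurable_fun_ltr => //; exact: measurable_thead.
- exact: (measurableT_comp (measurable_sheet true)).
- exact: (measurableT_comp (measurable_sheet false)).
Qed.

Lemma measurable_horo_density : measurable_fun setT horo_density.
Proof.
apply: (measurableT_comp measurable_fun_invr); apply: measurable_funX.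
by apply: measurableT_comp => //; exact: measurable_thead.
Qed.

Lemma horo_density_ge0 y : (0 <= horo_density y)%R.
Proof. by rewrite invr_ge0 exprn_ge0. Qed.

Lemma height_cons (z : R) (x : m.-tuple R) :
  height [tuple of z :: x] = Num.sqrt (z ^+ 2 + (1 + sqnorm x)).
Proof.
rewrite /height big_ord_recl tnth0 addrCA; congr (Num.sqrt (_ + (_ + _)))%R.
by apply: eq_bigr => i _; rewrite tnthS.
Qed.

Lemma horo_point_scale (s : R) (x : m.-tuple R) : s != 0%R ->
  horo_point [tuple of s :: scale_tuple s x] = sheet (s < 0)%R (horo_coord s x).
Proof.
move=> s0; rewrite /horo_point theadE; congr (sheet _ (horo_coord _ _)).
apply: eq_from_tnth => i; rewrite tnth_mktuple.
have -> : [tuple of behead [tuple of s :: scale_tuple s x]] = scale_tuple s x :> m.-tuple R.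
  exact: val_inj.
by rewrite tnth_mktuple mulKf.
Qed.

(** For fixed s the substitution X = s x contributes |s|^m; for fixed x the one-dimensional
substitution turns dz / height into ds / |s|. Two applications of Tonelli exchange the
order of these two steps. *)
Lemma lorentz_measure_horo (A : set Hn) : measurable A ->
  lorentz_measure R m.+1 A =
  \int[lebesgueRn R m.+1]_(y in horo_point @^-1` A) (horo_density y)%:E.
Proof.
move=> mA.
pose chi (q : Hn) : R := \1_A q.
have chi0 q : (0 <= chi q)%R by rewrite /chi indicE.
have mchi : measurable_fun setT chi by exact: measurable_indic.
have msheet b : measurable_fun setT (fun x : m.+1.-tuple R => chi (sheet b x)).
  exact: (measurableT_comp mchi (measurable_sheet b)).
have toChi d (T : measurableType d) (l : {measure set T -> \bar R}) (phi : T -> Hn)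
    (w : T -> R) :
    \int[l]_(y in phi @^-1` A) (w y)%:E = \int[l]_y ((chi (phi y))%:E * (w y)%:E).
  rewrite integral_mkcond; apply: eq_integral => y _.
  rewrite patchE /chi indicE; have [h|h] := pselect (A (phi y)).
    by rewrite !mem_set// mul1e.
  by rewrite !memNset// mul0e.
(* The contribution of the sheet b to the integrand in the coordinates (s, x). *)
pose K (b : bool) (s : R) (x : m.-tuple R) : \bar R :=
  (chi (sheet b (horo_coord s x)))%:E * (`|s|^-1 * (0 < (-1) ^+ b * s)%R%:R)%:E.
have K0 b s x : 0 <= K b s x by rewrite mule_ge0 ?lee_fin ?chi0 ?mulr_ge0.
have mK b : measurable_fun setT (fun z : R * m.-tuple R => K b z.1 z.2).
  apply: emeasurable_funM; apply/measurable_EFinP.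
    exact: (measurableT_comp (msheet b) measurable_horo_coord).
  apply: measurable_funM.
    by apply: (measurableT_comp measurable_fun_invr); exact: measurableT_comp.
  apply: (measurableT_comp measurable_pos_indic).
  by apply: (measurableT_comp (mulrl_measurable _)).
rewrite toChi.
transitivity (\int[leb]_s \int[mu]_x (K true s x + K false s x)); last first.
  rewrite ge0_integral_lebesgueRnS; last 2 first.
  - apply: emeasurable_funM; apply/measurable_EFinP.
      exact: (measurableT_comp mchi measurable_horo_point).
    exact: measurable_horo_density.
  - by move=> y; rewrite mule_ge0// lee_fin// horo_density_ge0.
  apply: eq_integral => s _; have [->|s0] := eqVneq s 0%R.
    rewrite !integral0_eq// => t _.
      by rewrite /horo_density theadE normr0 expr0n/= invr0 mule0.
    by rewrite /K normr0 invr0 !mul0r !mule0 adde0.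
  rewrite [RHS](ge0_integral_lebesgueRn_scale s0); last 2 first.
  - apply: emeasurable_funM; apply/measurable_EFinP.
      apply: (measurableT_comp mchi).
      exact: (measurableT_comp measurable_horo_point (measurable_consr s)).
    exact: (measurableT_comp measurable_horo_density (measurable_consr s)).
  - by move=> y; rewrite mule_ge0// lee_fin// horo_density_ge0.
  have s1 : (0 < `|s|)%R by rewrite normr_gt0.
  transitivity ((`|s| ^+ m)%:E * \int[mu]_x ((`|s| ^- m)%:E *
      (chi (sheet (s < 0)%R (horo_coord s x)) * `|s|^-1)%:E)); last first.
    congr (_ * _); apply: eq_integral => x _.
    rewrite horo_point_scale// /horo_density theadE -!EFinM exprS invfM; congr EFin.
    by ring.
  rewrite ge0_integralZl_EFin ?invr_ge0 ?exprn_ge0//; last 2 first.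
  - by move=> x _; rewrite lee_fin mulr_ge0.
  - apply/measurable_EFinP; apply: measurable_funM => //.
    apply: (measurableT_comp (msheet _)).
    exact: (measurableT_comp measurable_horo_coord (pair1_measurable s)).
  rewrite muleA -EFinM mulfV ?mul1e ?gt_eqF ?exprn_gt0//.
  apply: eq_integral => x _; rewrite /K expr0 expr1 mul1r mulN1r oppr_gt0.
  have [h|h|/eqP] := ltgtP s 0%R; last by rewrite (negbTE s0).
    by rewrite !mulr0 mule0 adde0 mulr1.
  by rewrite !mulr0 mule0 add0e mulr1.
have mKs b s : measurable_fun setT (K b s).
  exact: (measurableT_comp (mK b) (pair1_measurable s)).
under [RHS]eq_integral => s _ do rewrite ge0_integralD//.
have mF b : measurable_fun setT (fun s => \int[mu]_x K b s x).
  exact: (@measurable_fun_fubini_tonelli_F _ _ _ _ _ mu (fun z => K b z.1 z.2)).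
rewrite ge0_integralD//; last 2 first.
- by move=> s _; exact: integral_ge0.
- by move=> s _; exact: integral_ge0.
rewrite /lorentz_measure big_bool/=.
have dE b (x : m.+1.-tuple R) : (`|(-1) ^+ b * height x|^-1 = (height x)^-1)%R.
  rewrite normrM normr_sign mul1r ger0_norm//.
  exact: le_trans (height_ge1 _).
suff E (b : bool) :
    \int[cons_measure lebesgueR mu]_(x in sheet b @^-1` A) (`|(-1) ^+ b * height x|^-1)%:E =
    \int[leb]_s \int[mu]_x K b s x by congr (_ + _); exact: E.
rewrite toChi.
under eq_integral => x _ do rewrite dE.
have mh : measurable_fun setT (fun x : m.+1.-tuple R => (height x)^-1)%R.
  by apply: (measurableT_comp measurable_fun_invr); exact: measurable_height.
have mg : measurable_fun setT
    (fun x : m.+1.-tuple R => (chi (sheet b x))%:E * ((height x)^-1)%:E).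
  by apply: emeasurable_funM; exact/measurable_EFinP.
have g0 (x : m.+1.-tuple R) : 0 <= (chi (sheet b x))%:E * ((height x)^-1)%:E.
  by rewrite mule_ge0 ?lee_fin ?chi0 ?invr_ge0 ?(le_trans _ (height_ge1 _)).
rewrite (ge0_integral_lebesgueRnS mg g0).
rewrite (@fubini_tonelli _ _ _ _ R (@lebesgueR R) mu
  (fun z => (chi (sheet b [tuple of z.1 :: z.2]))%:E * ((height [tuple of z.1 :: z.2])^-1)%:E)); last 2 first.
- exact: (measurableT_comp mg (@measurable_cons_tuple R m)).
- by move=> z; exact: g0.
rewrite [RHS](@fubini_tonelli _ _ _ _ R (@lebesgueR R) mu
  (fun z => K b z.1 z.2) (mK b) (fun z => K0 b z.1 z.2)).
apply: eq_integral => x _.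
under eq_integral => z _ do rewrite height_cons.
rewrite (horo_substitution_sheet b (c := (1 + sqnorm x)%R)
  (F := fun z => (chi (sheet b [tuple of z :: x]))%:E))//.
- by rewrite ltr_pwDl// sqnorm_ge0.
- apply/measurable_EFinP.
  apply: (measurableT_comp (msheet b)).
  exact: (measurableT_comp (@measurable_cons_tuple R m) (pair2_measurable x)).
- by move=> z; rewrite lee_fin.
Qed.

End horospherical.

(** * The Minkowski form in horospherical coordinates *)

Section geometry.
Local Open Scope ereal_scope.
Context {R : realType} {m : nat}.
Local Notation leb := (@lebesgueR R : {measure set R -> \bar R}).
Local Notation Hn := (hyperboloid R m.+1).
Implicit Types y t : m.+1.-tuple R.

Lemma scale_tupleVK k (c : R) (x : k.-tuple R) : c != 0%R ->
  x = scale_tuple c (scale_tuple c^-1 x).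
Proof.
by move=> c0; apply: eq_from_tnth => i; rewrite !tnth_mktuple mulVKf.
Qed.

Lemma sqnorm_cons_scale (s : R) (x : m.-tuple R) :
  sqnorm [tuple of s :: scale_tuple s x] = (s ^+ 2 * (1 + sqnorm x))%R.
Proof.
rewrite mulrDr mulr1 -sqnorm_scale /sqnorm big_ord_recl tnth0.
by congr (_ + _)%R; apply: eq_bigr => i _; rewrite tnthS.
Qed.

Lemma horo_point_last y : thead y != 0%R ->
  (hval (horo_point y)).2 =
  ((1 + sqnorm y) / (2 * thead y))%R.
Proof.
case/tupleP: y => s X; rewrite theadE => s0.
have -> : X = scale_tuple s (scale_tuple s^-1 X) by exact: scale_tupleVK.
set x := scale_tuple s^-1 X; rewrite horo_point_scale//= /horo_coord height_cons.
rewrite sqnorm_cons_scale.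
set c := (1 + sqnorm x)%R; have c0 : (0 < c)%R by rewrite ltr_pwDl// sqnorm_ge0.
have -> : (horo c s ^+ 2 + c = ((s^-1 + c * s) / 2) ^+ 2)%R by rewrite /horo; field.
rewrite sqrtr_sqr.
have -> : (`|(s^-1 + c * s) / 2| = (-1) ^+ (s < 0)%R * ((s^-1 + c * s) / 2))%R.
  have [s1|s1|/eqP] := ltgtP s 0%R; last by rewrite (negbTE s0).
    rewrite ltr0_norm ?expr1 ?mulN1r// pmulr_llt0 ?invr_gt0//.
    by rewrite -oppr_gt0 opprD addr_gt0// oppr_gt0 ?invr_lt0// pmulr_rlt0.
  rewrite gtr0_norm ?expr0 ?mul1r// divr_gt0// addr_gt0 ?invr_gt0// mulr_gt0//.
rewrite mulrA -expr2 sqrr_sign mul1r.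
by field.
Qed.

Lemma norm_horo_point_last y : thead y != 0%R ->
  `|(hval (horo_point y)).2|%R = ((1 + sqnorm y) / (2 * `|thead y|))%R.
Proof.
move=> y0; rewrite horo_point_last// normrM normfV normrM.
rewrite [in LHS]ger0_norm ?addr_ge0 ?sqnorm_ge0//.
by rewrite (@ger0_norm _ 2%R).
Qed.

(** For null coordinates q_(n+1) + q_1 = 1 / s and q_(n+1) - q_1 = (1 + |x|^2) s, the form
splits into products of null coordinates, and the numerator becomes a square. *)
Lemma minkowski_form_horo_point y t : thead y != 0%R -> thead t != 0%R ->
  (minkowski_form (hval (horo_point y)) (hval (horo_point t)) - 1 =
   sqdist y t / (2 * (thead y * thead t)))%R.
Proof.
move=> y0 t0; rewrite /minkowski_form !horo_point_last//.
case/tupleP: y y0 => s X; case/tupleP: t t0 => r Y; rewrite !theadE => r0 s0.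
have eX : X = scale_tuple s (scale_tuple s^-1 X) by exact: scale_tupleVK.
have eY : Y = scale_tuple r (scale_tuple r^-1 Y) by exact: scale_tupleVK.
move: (scale_tuple s^-1 X) (scale_tuple r^-1 Y) eX eY => x y -> -> {X Y}.
rewrite !horo_point_scale//= /horo_coord.
have ->: (\sum_(i < m.+1) tnth [tuple of horo (1 + sqnorm x) s :: x] i *
     tnth [tuple of horo (1 + sqnorm y) r :: y] i =
    horo (1 + sqnorm x) s * horo (1 + sqnorm y) r + \sum_(i < m) tnth x i * tnth y i)%R.
  rewrite big_ord_recl !tnth0; congr (_ + _)%R.
  by apply: eq_bigr => i _; rewrite !tnthS.
have -> : (sqdist [tuple of s :: scale_tuple s x] [tuple of r :: scale_tuple r y] =
    (s - r) ^+ 2 + (s ^+ 2 * sqnorm x + r ^+ 2 * sqnorm y -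
    2 * s * r * \sum_(i < m) tnth x i * tnth y i))%R.
  rewrite /sqdist big_ord_recl !tnth0; congr (_ + _)%R.
  rewrite /sqnorm !mulr_sumr -big_split/= -sumrB; apply: eq_bigr => i _.
  by rewrite !tnthS !tnth_mktuple; ring.
rewrite !sqnorm_cons_scale /horo; field.
by rewrite r0 s0.
Qed.

(** Cauchy-Schwarz for (q_1, ..., q_n, 1) and (t_1, ..., t_n, 1), whose norms are
|q_(n+1)| and |t_(n+1)|. *)
Lemma minkowski_form_le (q t : Hn) :
  (`|minkowski_form (hval q) (hval t) - 1| <= 2 * (`|(hval q).2| * `|(hval t).2|))%R.
Proof.
case: q => -[x a] /= hq; case: t => -[y b] /= ht.
rewrite /minkowski_form/=; set S := (\sum_(i < m.+1) _)%R.
move: hq ht; rewrite /on_hyperboloid/= !subr_eq addrC => /eqP hq.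
rewrite addrC => /eqP ht.
have {}hq : (a ^+ 2 = 1 + sqnorm x)%R by rewrite /sqnorm hq; ring.
have {}ht : (b ^+ 2 = 1 + sqnorm y)%R by rewrite /sqnorm ht; ring.
have CS e : (e ^+ 2 = 1 -> 0 <= a ^+ 2 * b ^+ 2 - e * (a * b) * (S + 1))%R.
  move=> e2.
  have : (0 <= sqnorm [tuple (b * tnth x i - e * a * tnth y i)%R | i < m.+1] +
     (b - e * a) ^+ 2)%R by rewrite addr_ge0 ?sqnorm_ge0 ?sqr_ge0.
  have -> : sqnorm [tuple (b * tnth x i - e * a * tnth y i)%R | i < m.+1] =
      (b ^+ 2 * sqnorm x + e ^+ 2 * a ^+ 2 * sqnorm y - 2 * e * (a * b) * S)%R.
    rewrite /sqnorm !mulr_sumr -big_split/= -sumrB; apply: eq_bigr => i _.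
    by rewrite tnth_mktuple; ring.
  have -> : sqnorm x = (a ^+ 2 - 1)%R by rewrite hq; ring.
  have -> : sqnorm y = (b ^+ 2 - 1)%R by rewrite ht; ring.
  rewrite e2 => h; rewrite -(pmulr_rge0 _ (_ : 0 < 2)%R)//.
  apply: le_trans h _; rewrite le_eqVlt; apply/orP; left; apply/eqP.
  have -> : ((b - e * a) ^+ 2 = b ^+ 2 + e ^+ 2 * a ^+ 2 - 2 * e * (a * b))%R by ring.
  by rewrite e2; ring.
have S1 : (`|S + 1| <= `|a| * `|b|)%R.
  have ab0 : (0 < `|a * b|)%R.
    by rewrite normr_gt0 mulf_neq0// -sqrf_eq0 ?hq ?ht gt_eqF// ltr_pwDl// sqnorm_ge0.
  rewrite -normrM -(ler_pM2l ab0) -normrM -expr2 real_normK ?num_real// exprMn.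
  have c1 := CS 1%R (expr1n _ _); have c2 := CS (- 1)%R (sqrr_sign _ 1%N).
  by rewrite ler_norml; apply/andP; split; lra.
rewrite (_ : _ - 1 = a * b - (S + 1))%R; last by ring.
apply: le_trans (ler_normB _ _) _.
by rewrite normrM mulr_natl mulr2n lerD2l.
Qed.

End geometry.

(** * The spherical density *)

Section conformal_density.
Local Open Scope ereal_scope.
Context {R : realType}.
Local Notation leb := (@lebesgueR R : {measure set R -> \bar R}).

(** The density of the volume of the unit sphere in stereographic coordinates; also the
function |q_(n+1)|^(-n) of the hyperboloid transferred to R^n. *)
Definition spherical_density n (y : n.-tuple R) : R := ((2 / (1 + sqnorm y)) ^+ n)%R.

Lemma one_sqnorm_gt0 n (y : n.-tuple R) : (0 < 1 + sqnorm y)%R.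
Proof. by rewrite ltr_pwDl// sqnorm_ge0. Qed.

Lemma spherical_density_ge0 n (y : n.-tuple R) : (0 <= spherical_density y)%R.
Proof. by rewrite exprn_ge0// divr_ge0// ltW// one_sqnorm_gt0. Qed.

Lemma measurable_spherical_density n : measurable_fun setT (@spherical_density n).
Proof.
apply: measurable_funX; apply: measurable_funM => //.
apply: (measurableT_comp measurable_fun_invr).
by apply: measurable_funD => //; exact: measurable_sqnorm.
Qed.

Lemma integral_lebesgueRn_prod n (g : R -> R) (c : R) :
  measurable_fun setT g -> (forall x, 0 <= g x)%R ->
  \int[leb]_x (g x)%:E = c%:E ->
  \int[lebesgueRn R n]_y (\prod_(i < n) g (tnth y i))%:E = (c ^+ n)%:E.
Proof.
move=> mg g0 gc; elim: n => [|n IH].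
  under eq_integral => y _ do rewrite big_ord0.
  by rewrite /= integral_dirac// diracT mul1e expr0.
have mprod k : measurable_fun setT (fun y : k.-tuple R => (\prod_(i < k) g (tnth y i))%R).
  apply: measurable_prod => i _; apply: (measurableT_comp mg); exact: measurable_tnth.
rewrite ge0_integral_lebesgueRnS; last 2 first.
- by apply/measurable_EFinP; exact: mprod.
- by move=> y; rewrite lee_fin prodr_ge0.
transitivity (\int[leb]_x ((c ^+ n)%:E * (g x)%:E)).
  apply: eq_integral => x _.
  under eq_integral => t _.
    rewrite big_ord_recl tnth0 EFinM.
    under eq_bigr => i _ do rewrite tnthS.
    over.
  rewrite ge0_integralZl_EFin//; last 2 first.
  - by move=> t _; rewrite lee_fin prodr_ge0.
  - by apply/measurable_EFinP; exact: mprod.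
  by rewrite IH muleC.
have c0 : (0 <= c)%R.
  by rewrite -lee_fin -gc; apply: integral_ge0 => x _; rewrite lee_fin.
rewrite ge0_integralZl_EFin ?exprn_ge0//; last 2 first.
- by move=> x _; rewrite lee_fin.
- exact/measurable_EFinP.
by rewrite gc -EFinM -exprSr.
Qed.

Lemma integral_oneDsqrV_fin : exists c : R, \int[leb]_x ((oneDsqr x)^-1)%:E = c%:E.
Proof.
have g0 (x : R) : (0 <= (oneDsqr x)^-1)%R.
  by rewrite invr_ge0 (le_trans ler01)// oneDsqr_ge1.
rewrite ge0_integral_lebesgueR//; last first.
  by apply/measurable_EFinP; apply: continuous_measurable_fun; exact: continuous_oneDsqrV.
rewrite (@ge0_symfun_integralT _ (fun x => (oneDsqr x)^-1)%R)//; last 2 first.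
- exact: continuous_oneDsqrV.
- by move=> x; rewrite /= /oneDsqr sqrrN.
rewrite (_ : [set x | (0 <= x)%R] = `[0%R, +oo[%classic); last first.
  by apply/seteqP; split => x /=; rewrite in_itv/= andbT.
by rewrite integral0y_oneDsqr; exists (2 * (pi / 2))%R.
Qed.

(** (1 + |y|^2)^n is at least the product of the 1 + y_i^2, and the integral of
1 / (1 + x^2) over the line is finite. *)
Lemma integral_spherical_density_lty n :
  \int[lebesgueRn R n]_y (spherical_density y)%:E < +oo.
Proof.
have [c gc] := integral_oneDsqrV_fin.
have mg : measurable_fun setT (fun x : R => (oneDsqr x)^-1)%R.
  by apply: continuous_measurable_fun; exact: continuous_oneDsqrV.
have g0 (x : R) : (0 <= (oneDsqr x)^-1)%R.
  by rewrite invr_ge0 (le_trans ler01)// oneDsqr_ge1.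
have mprod : measurable_fun setT
    (fun y : n.-tuple R => (\prod_(i < n) (oneDsqr (tnth y i))^-1)%R).
  apply: measurable_prod => i _; apply: (measurableT_comp mg); exact: measurable_tnth.
apply: (@le_lt_trans _ _ (\int[lebesgueRn R n]_y
   ((2 ^+ n)%:E * (\prod_(i < n) (oneDsqr (tnth y i))^-1)%:E))).
  apply: ge0_le_integral => //.
  - by move=> y _; rewrite lee_fin spherical_density_ge0.
  - by apply/measurable_EFinP; exact: measurable_spherical_density.
  - by apply: measurable_funeM; exact/measurable_EFinP.
  - move=> y _; rewrite -EFinM lee_fin /spherical_density exprMn ler_pM2l ?exprn_gt0//.
    rewrite -[X in (_ ^+ X <= _)%R](card_ord n) -prodr_const; apply: ler_prod => i _.
    rewrite invr_ge0 (ltW (one_sqnorm_gt0 y))/= lef_pV2 ?posrE ?one_sqnorm_gt0//.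
    rewrite lerD2l /sqnorm (bigD1 i)//= lerDl sumr_ge0// => j _; exact: sqr_ge0.
rewrite ge0_integralZl_EFin ?exprn_ge0//; last 2 first.
- by move=> y _; rewrite lee_fin prodr_ge0.
- exact/measurable_EFinP.
by rewrite (integral_lebesgueRn_prod _ mg g0 gc) -EFinM ltry.
Qed.

Lemma integral_spherical_density_gt0 n :
  0 < \int[lebesgueRn R n]_y (spherical_density y)%:E.
Proof.
apply: (@lt_le_trans _ _ (\int[lebesgueRn R n]_y (\1_(@cball R n 1) y)%:E)).
  rewrite integral_indic ?setIT//; last exact: measurable_cball.
  by have := @ball_volume_gt0 R n; rewrite -lte_fin -ball_volumeE.
apply: ge0_le_integral => //.
- by apply/measurable_EFinP/measurable_indic; exact: measurable_cball.
- by apply/measurable_EFinP; exact: measurable_spherical_density.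
- move=> y _; rewrite lee_fin indicE; have [h|h] := pselect (@cball R n 1 y).
    rewrite mem_set// /spherical_density exprn_ege1// ler_pdivlMr ?one_sqnorm_gt0// mul1r.
    by move: h; rewrite /cball/= expr1n; lra.
  by rewrite memNset// spherical_density_ge0.
Qed.

(** The spherical density is at least (2 / (1 + r^2))^n on the ball of radius r = e^(c/n),
which bounds its distribution profile from below by 2^n * profile n c. *)
Lemma profile_le_spherical_density n : (0 < n)%N ->
  (2 ^+ n)%:E * \int[leb]_c (profile n c)%:E <=
  \int[lebesgueRn R n]_y (spherical_density y)%:E.
Proof.
move=> n0; rewrite (@integral_distribution_profile R n (@spherical_density n)); last 2 first.
- exact: measurable_spherical_density.
- by move=> y; exact: spherical_density_ge0.
rewrite -ge0_integralZl_EFin ?exprn_ge0//; last 2 first.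
- by move=> c _; rewrite lee_fin profile_ge0.
- by apply/measurable_EFinP; exact: measurable_profile.
apply: ge0_le_integral => //.
- by move=> c _; rewrite mule_ge0// lee_fin ?exprn_ge0 ?profile_ge0.
- by apply: measurable_funeM; apply/measurable_EFinP; exact: measurable_profile.
- apply: measurable_distribution_profile; exact: measurable_spherical_density.
move=> c _; pose r := expR (c / n%:R).
have r0 : (0 < r)%R by exact: expR_gt0.
have rE : (expR (2 * c / n%:R) = r ^+ 2)%R by rewrite -expRM_natl mulrA.
have d0 : (0 < 1 + r ^+ 2)%R by rewrite ltr_pwDl// sqr_ge0.
pose tau := ((2 / (1 + r ^+ 2)) ^+ n)%R.
have tau0 : (0 < tau)%R by rewrite exprn_gt0// divr_gt0.
have w0 : (0 < ball_volume n * expR c)%R by rewrite mulr_gt0 ?ball_volume_gt0 ?expR_gt0.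
rewrite /distribution_profile /profile rE.
rewrite (_ : (2 ^+ n)%:E * _ = (ball_volume n * expR c)%:E * tau%:E); last first.
  rewrite -!EFinM /tau expr_div_n; congr EFin; field.
  by rewrite expf_neq0// gt_eqF.
rewrite lee_pmul2l ?lte_fin//.
rewrite -[tau]subr0 -(lebesgueR_itv false false (ltW tau0)).
apply: le_measure; rewrite ?inE.
- exact: measurable_itv.
- rewrite (_ : [set _ | _] = `]0%R, +oo[%classic `&`
    [set t | (ball_volume n * expR c)%:E <=
       lebesgueRn R n [set x | t%:E <= (spherical_density x)%:E]]).
    apply: measurableI => //; rewrite -[X in measurable X]setTI.
    apply: measurable_lee => //.
    apply: (@measurable_measure_superlevel _ _ _ _ (EFin \o @spherical_density n)).
    by apply/measurable_EFinP; exact: measurable_spherical_density.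
  by apply/seteqP; split => t /=; rewrite in_itv/= andbT.
move=> t /=; rewrite in_itv/= => /andP[t0 ttau]; split=> //.
rewrite -(expR_div_natK c n0) mulrC -/r -lebesgueRn_cball//.
apply: le_measure; rewrite ?inE.
- exact: measurable_cball.
- apply: measurable_superlevel; apply/measurable_EFinP.
  exact: measurable_spherical_density.
move=> y; rewrite /cball/= lee_fin => yr; apply: le_trans ttau _.
have d1 : (0 < 1 + sqnorm y)%R by exact: one_sqnorm_gt0.
rewrite /tau /spherical_density ler_pXn2r// ?nnegrE ?(ltW (divr_gt0 _ _))//.
by rewrite ler_pM2l// lef_pV2 ?posrE// lerD2l.
Qed.

End conformal_density.

(** * The inequality on the hyperboloid *)

Section hyperboloid_inequality.
Local Open Scope ereal_scope.
Context {R : realType} {m : nat}.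
Local Notation n := m.+1.
Local Notation leb := (@lebesgueR R : {measure set R -> \bar R}).
Local Notation Hn := (hyperboloid R n).
Local Notation nu := (lorentz_measure R n).
Local Notation mu := (lebesgueRn R n).
Implicit Types y t : n.-tuple R.

Lemma ge0_integral_lorentz (f : Hn -> \bar R) :
  measurable_fun setT f -> (forall q, 0 <= f q) ->
  \int[nu]_q f q = \int[mu]_y (f (horo_point y) * (horo_density y)%:E).
Proof.
move=> mf f0; apply: ge0_integral_pushforward_density => //.
- exact: measurable_horo_point.
- exact: measurable_horo_density.
- by move=> y; exact: horo_density_ge0.
- by move=> A mA; exact: lorentz_measure_horo.
Qed.

Lemma horo_density_eq0 y : (horo_density y == 0%R) = (thead y == 0%R).
Proof. by rewrite /horo_density invr_eq0 expf_eq0/= normr_eq0. Qed.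

Lemma measurable_last : measurable_fun setT (fun q : Hn => (hval q).2).
Proof. exact: (measurableT_comp measurable_snd measurable_hval). Qed.



(** A null set of pairs on the hyperboloid is null in horospherical coordinates, away from
s = 0, because the density |s|^(-n) does not vanish there. *)
Lemma ae_horospherical (N : set (Hn * Hn)) : measurable N -> (nu \x nu) N = 0 ->
  {ae mu, forall y, {ae mu, forall t,
     thead y != 0%R -> thead t != 0%R -> ~ N (horo_point y, horo_point t)}}.
Proof.
move=> mN N0.
have mF : measurable_fun setT (nu \o xsection N) by exact: measurable_fun_xsection.
have : \int[mu]_y `|(nu \o xsection N) (horo_point y) * (horo_density y)%:E| = 0.
  rewrite -[RHS]N0 [RHS]/product_measure1 ge0_integral_lorentz//.
  by apply: eq_integral => y _; rewrite gee0_abs// mule_ge0// lee_fin horo_density_ge0.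
move/ae_eq_integral_abs => /(_ measurableT) h.
have {h} : ae_eq mu setT (fun y => (nu \o xsection N) (horo_point y) * (horo_density y)%:E)
    (cst 0).
  apply: h; apply: emeasurable_funM.
    exact: (measurableT_comp mF measurable_horo_point).
  by apply/measurable_EFinP; exact: measurable_horo_density.
apply: filterS => y /(_ I)/eqP; rewrite mule_eq0 => /orP[|]; last first.
  rewrite eqe horo_density_eq0 => /eqP y0.
  by apply: aeW => t; rewrite y0 eqxx.
move=> /eqP /= h.
have mX : measurable (xsection N (horo_point y)) by exact: measurable_xsection.
have mpre : measurable (horo_point @^-1` xsection N (horo_point y)).
  by rewrite -[X in measurable X]setTI; exact: measurable_horo_point.
rewrite lorentz_measure_horo// in h.
have {}h : \int[mu]_(t in horo_point @^-1` xsection N (horo_point y))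
    `|(horo_density t)%:E| = 0.
  rewrite -[RHS]h; apply: eq_integral => t _.
  by rewrite gee0_abs// lee_fin horo_density_ge0.
move/ae_eq_integral_abs : h => /(_ mpre) h.
have {h} : ae_eq mu (horo_point @^-1` xsection N (horo_point y))
    (fun t => (horo_density t)%:E) (cst 0).
  by apply: h; apply/measurable_EFinP/measurable_funTS; exact: measurable_horo_density.
apply: filterS => t ht y0 t0 Nyt.
have Pt : (horo_point @^-1` xsection N (horo_point y)) t.
  by rewrite /xsection/= inE.
by have /eqP := ht Pt; rewrite eqe horo_density_eq0 (negbTE t0).
Qed.

Lemma ae_thead_neq0 : {ae mu, forall y, thead y != 0%R}.
Proof.
pose N := [set y : n.-tuple R | thead y = 0%R].
have mN : measurable N.
  rewrite (_ : N = (fun y : n.-tuple R => thead y) @^-1` [set 0%R])//.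
  rewrite -[X in measurable X]setTI; exact: measurable_thead.
exists N; split => //; last by move=> y /= /negP; rewrite negbK => /eqP.
rewrite -[N]setIT -integral_indic//.
have mI : measurable_fun setT (fun y : n.-tuple R => (\1_N y : R)%:E).
  exact/measurable_EFinP/measurable_indic.
have I0 y : 0 <= (\1_N y : R)%:E by rewrite lee_fin.
rewrite (ge0_integral_lebesgueRnS mI I0).
transitivity (\int[leb]_(x in [set 0%R]) \int[lebesgueRn R m]_t (\1_N [tuple of x :: t])%:E).
  rewrite [RHS]integral_mkcond; apply: eq_integral => x _.
  rewrite patchE; case: ifPn => [//|x0]; apply: integral0_eq => t _.
  rewrite indicE memNset// /N/= theadE => x0'.
  by move/negP: x0; apply; rewrite inE.
apply: null_set_integral => //; last exact: lebesgueR_set1.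
by apply: measurable_funTS; exact: (measurable_integral_cons mI I0).
Qed.

(** |q_(n+1)| = (1 + |y|^2) / (2 |s|), so the powers of |s| cancel. *)
Lemma integral_extremal :
  \int[nu]_q (`|(hval q).2| ^- n)%:E = \int[mu]_y (spherical_density y)%:E.
Proof.
rewrite ge0_integral_lorentz; last 2 first.
- apply/measurable_EFinP; apply: (measurableT_comp measurable_fun_invr).
  by apply: measurable_funX; apply: measurableT_comp => //; exact: measurable_last.
- by move=> q; rewrite lee_fin invr_ge0 exprn_ge0.
apply: ge0_ae_eq_integral => //.
- apply: emeasurable_funM; apply/measurable_EFinP; last exact: measurable_horo_density.
  apply: (measurableT_comp measurable_fun_invr); apply: measurable_funX.
  apply: measurableT_comp => //.
  exact: (measurableT_comp measurable_last measurable_horo_point).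
- by apply/measurable_EFinP; exact: measurable_spherical_density.
- by move=> y _; rewrite mule_ge0// lee_fin ?invr_ge0 ?exprn_ge0// horo_density_ge0.
- by move=> y _; rewrite lee_fin spherical_density_ge0.
apply: filterS ae_thead_neq0 => y y0 _.
rewrite -EFinM /horo_density /spherical_density norm_horo_point_last//.
have := one_sqnorm_gt0 y; set c := (1 + sqnorm y)%R => c0.
have s0 : (0 < `|thead y|)%R by rewrite normr_gt0.
congr EFin; rewrite -!exprVn -exprMn; congr (_ ^+ _)%R.
by field; rewrite !gt_eqF.
Qed.

(** The case p = 1 of the theorem, to which the general case reduces by taking powers. *)
Lemma hyperboloid_sup_inequality (u v : Hn -> R) (M P Q : R) : (0 < M)%R ->
  measurable_fun setT u -> measurable_fun setT v ->
  (forall q, 0 <= u q)%R -> (forall q, 0 <= v q)%R ->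
  {ae (nu \x nu), forall z : Hn * Hn,
     (u z.1 * v z.2 * `|minkowski_form (hval z.1) (hval z.2) - 1| ^+ n <= M)%R} ->
  \int[nu]_q (u q)%:E = P%:E -> \int[nu]_q (v q)%:E = Q%:E ->
  (2 ^+ n * (P * Q) <= M * fine (\int[mu]_y (spherical_density y)%:E) ^+ 2)%R.
Proof.
move=> M0 mu_ mv u0 v0 [N [mN N0 Nae]] uP vQ.
have [c c_ge0 cE] : exists2 c : R, (0 <= c)%R & \int[mu]_y (spherical_density y)%:E = c%:E.
  have c0 := @integral_spherical_density_gt0 R n.
  exists (fine (\int[mu]_y (spherical_density y)%:E)); first by rewrite fine_ge0// ltW.
  by rewrite fineK// ge0_fin_numE ?integral_spherical_density_lty// ltW.
rewrite cE/=.
have P0 : (0 <= P)%R by rewrite -lee_fin -uP; apply: integral_ge0 => q _; rewrite lee_fin.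
have Q0 : (0 <= Q)%R by rewrite -lee_fin -vQ; apply: integral_ge0 => q _; rewrite lee_fin.
have rhs0 : (0 <= M * c ^+ 2)%R by rewrite mulr_ge0 ?sqr_ge0// ltW.
move: P0; rewrite le_eqVlt => /predU1P[<-|P0]; first by rewrite mul0r mulr0.
move: Q0; rewrite le_eqVlt => /predU1P[<-|Q0]; first by rewrite !mulr0.
pose U f y : R := (f (horo_point y) * horo_density y)%R.
have mU (f : Hn -> R) : measurable_fun setT f -> measurable_fun setT (U f).
  move=> mf; apply: measurable_funM; last exact: measurable_horo_density.
  exact: (measurableT_comp mf measurable_horo_point).
have U0 (f : Hn -> R) : (forall q, 0 <= f q)%R -> forall y, (0 <= U f y)%R.
  by move=> f0 y; rewrite mulr_ge0// horo_density_ge0.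
have intU (f : Hn -> R) (r : R) : measurable_fun setT f -> (forall q, 0 <= f q)%R ->
    \int[nu]_q (f q)%:E = r%:E -> r%:E <= \int[mu]_y (U f y)%:E.
  move=> mf f0 <-; rewrite ge0_integral_lorentz//; first exact/measurable_EFinP.
have M'0 : (0 < 2 ^+ n * M)%R by rewrite mulr_gt0// exprn_gt0.
have := euclidean_sup_inequality (ltn0Sn m) M'0 (mU _ mu_) (mU _ mv) (U0 _ u0) (U0 _ v0)
  _ P0 Q0 (intU _ _ mu_ u0 uP) (intU _ _ mv v0 vQ).
move=> /(_ _)/wrap[|H].
  apply: filterS (ae_horospherical mN N0) => y hy; apply: filterS hy => t ht.
  have [y0|y0] := eqVneq (thead y) 0%R.
    by rewrite /U (eqP (_ : horo_density y == 0%R)) ?horo_density_eq0 ?y0// mulr0 !mul0r ltW.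
  have [t0|t0] := eqVneq (thead t) 0%R.
    by rewrite /U (eqP (_ : horo_density t == 0%R)) ?horo_density_eq0 ?t0// !mulr0 !mul0r ltW.
  have : (u (horo_point y) * v (horo_point t) *
      `|minkowski_form (hval (horo_point y)) (hval (horo_point t)) - 1| ^+ n <= M)%R.
    by apply: contrapT => h; apply: (ht y0 t0); exact: Nae.
  rewrite minkowski_form_horo_point// => h.
  apply: (@le_trans _ _ (2 ^+ n * (u (horo_point y) * v (horo_point t) *
      `|sqdist y t / (2 * (thead y * thead t))| ^+ n)))%R; last first.
    by rewrite ler_pM2l// exprn_gt0.
  rewrite le_eqVlt; apply/orP; left; apply/eqP.
  rewrite normrM normfV !normrM (ger0_norm (sqdist_ge0 _ _)) (@ger0_norm _ 2%R)//.
  rewrite /U /horo_density expr_div_n !exprMn.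
  by field; rewrite !expf_neq0 ?normr_eq0.
have Kc : (2 ^+ n)%:E * \int[leb]_c (profile n c)%:E <= c%:E.
  by rewrite -cE; exact: profile_le_spherical_density.
have two0 : (0 < 2 ^+ n :> R)%R by rewrite exprn_gt0.
have {}H : (Num.sqrt (P * Q) <= Num.sqrt (2 ^+ n * M) * (c / 2 ^+ n))%R.
  rewrite -lee_fin (le_trans H)// EFinM lee_wpmul2l ?lee_fin ?sqrtr_ge0//.
  by rewrite mulrC EFinM lee_pdivlMl.
have {}H : (P * Q <= (2 ^+ n * M) * (c / 2 ^+ n) ^+ 2)%R.
  rewrite -(sqr_sqrtr (ltW (mulr_gt0 P0 Q0))) -(sqr_sqrtr (ltW M'0)) -exprMn.
  by rewrite ler_sqr ?nnegrE ?mulr_ge0 ?sqrtr_ge0 ?divr_ge0// ltW.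
rewrite -(ler_pM2l two0) in H; apply: (le_trans H); rewrite le_eqVlt; apply/orP; left.
by apply/eqP; field; rewrite gt_eqF.
Qed.

End hyperboloid_inequality.

(** * Extremal functions and the sharp constant *)

Section norms.
Local Open Scope ereal_scope.
Context d (T : measurableType d) {R : realType}.
Variable nu : {measure set T -> \bar R}.

Lemma Lnorm_nonneg (p P : R) (F : T -> R) : (forall q, 0 <= F q)%R ->
  \int[nu]_q (F q `^ p)%:E = P%:E -> 'N[nu]_p%:E[EFin \o F] = (P `^ p^-1)%:E.
Proof.
move=> F0 FP.
rewrite unlock /Lnorm.
have -> : \int[nu]_q (`|(EFin \o F) q| `^ p) = P%:E.
  by rewrite -FP; apply: eq_integral => q _; rewrite /= ger0_norm.
exact: poweR_EFin.
Qed.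

Lemma Lfun_integral_powR (p : R) (F : T -> R) : (0 < p)%R -> (forall q, 0 <= F q)%R ->
  F \in Lfun nu p%:E ->
  measurable_fun setT F /\ exists P : R, \int[nu]_q (F q `^ p)%:E = P%:E.
Proof.
move=> p0 F0 /andP[/set_mem mF /set_mem finF]; split=> //.
have : 'N[nu]_p%:E[EFin \o F] < +oo by exact: finF.
rewrite unlock /Lnorm (_ : \int[nu]_x _ = \int[nu]_q (F q `^ p)%:E); last first.
  by apply: eq_integral => q _; rewrite /= ger0_norm// poweR_EFin.
have : 0 <= \int[nu]_q (F q `^ p)%:E.
  by apply: integral_ge0 => q _; rewrite lee_fin powR_ge0.
case: (\int[nu]_q _) => [r||]//; first by move=> _ _; exists r.
by move=> _; rewrite (@eqy_poweR _ _ p^-1) ?invr_gt0.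
Qed.

Lemma Lfun_of_integral_powR (p P : R) (F : T -> R) : (forall q, 0 <= F q)%R ->
  measurable_fun setT F -> \int[nu]_q (F q `^ p)%:E = P%:E -> F \in Lfun nu p%:E.
Proof.
move=> F0 mF FP; apply/andP; split; apply/mem_set => //.
by rewrite /= /finite_norm (Lnorm_nonneg F0 FP) ltry.
Qed.

End norms.

Lemma powR_exprn (R : realType) (x r : R) k : 0 <= x -> (x ^+ k) `^ r = (x `^ r) ^+ k.
Proof.
move=> x0; rewrite -(powR_mulrn k x0) -(powR_mulrn k (powR_ge0 x r)).
by rewrite -powRrM mulrC powRrM.
Qed.

Lemma powR_root_scaling (R : realType) (n : nat) (p V M : R) : 0 < p -> 0 <= V -> 0 <= M ->
  (V `^ p^-1) ^+ 2 / 2 `^ (n%:R / p) * M = (M `^ p * V ^+ 2 / 2 ^+ n) `^ p^-1.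
Proof.
move=> p0 V0 M0.
have two0 : 0 <= 2 ^- n :> R by rewrite invr_ge0 exprn_ge0.
rewrite powRM ?mulr_ge0 ?powR_ge0 ?sqr_ge0// powRM ?powR_ge0 ?sqr_ge0//.
rewrite -powRrM mulfV ?gt_eqF// powRr1// powR_exprn//.
have -> : (2 ^- n) `^ p^-1 = (2 `^ (n%:R / p))^-1 :> R.
  by rewrite -powR_mulrn// -powRN -powRrM mulNr powRN.
by rewrite mulrAC [(_ * M)%R]mulrC.
Qed.

Section sharp_constant.
Local Open Scope ereal_scope.
Context {R : realType} {m : nat}.
Local Notation n := m.+1.
Local Notation Hn := (hyperboloid R n).
Local Notation nu := (lorentz_measure R n).

(** The volume of the unit sphere of dimension n, by spherical_density. *)
Definition sphere_volume : R :=
  fine (\int[lebesgueRn R n]_y (spherical_density y)%:E).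

Lemma sphere_volumeE :
  \int[lebesgueRn R n]_y (spherical_density y)%:E = sphere_volume%:E.
Proof.
by rewrite fineK// ge0_fin_numE ?integral_spherical_density_lty// ltW//
  integral_spherical_density_gt0.
Qed.

Lemma sphere_volume_gt0 : (0 < sphere_volume)%R.
Proof. by rewrite -lte_fin -sphere_volumeE integral_spherical_density_gt0. Qed.

Definition sharp_constant (p : R) : R :=
  ((sphere_volume `^ p^-1) ^+ 2 / 2 `^ (n%:R / p))%R.

Lemma sharp_constantE (p : R) :
  ((sphere_volume `^ p^-1) ^+ 2 = sharp_constant p * 2 `^ (n%:R / p))%R.
Proof. by rewrite /sharp_constant divfK// gt_eqF// powR_gt0. Qed.

Lemma sharp_constant_gt0 (p : R) : (0 < sharp_constant p)%R.
Proof. by rewrite divr_gt0 ?exprn_gt0 ?powR_gt0// sphere_volume_gt0. Qed.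

Lemma extremal_powR (p : R) (q : Hn) : (0 < p)%R ->
  (extremal p q `^ p = `|(hval q).2| ^- n)%R.
Proof.
move=> p0; rewrite /extremal -powRrM mulNr divfK ?gt_eqF//.
by rewrite powRN powR_mulrn.
Qed.

Lemma hval_last_neq0 (q : Hn) : (hval q).2 != 0%R.
Proof.
case: q => -[x a] /= h; apply: contraTneq h => ->.
rewrite /on_hyperboloid/= expr0n/= subr0 gt_eqF//.
by rewrite (lt_le_trans (ltrN10 R))// sumr_ge0// => i _; exact: sqr_ge0.
Qed.

Lemma measurable_extremal (p : R) : measurable_fun setT (@extremal R n p).
Proof.
apply: (measurableT_comp (@measurable_powR R _)).
by apply: measurableT_comp => //; exact: measurable_last.
Qed.

Lemma integral_scaled_extremal (p a : R) : (0 < p)%R -> (0 < a)%R ->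
  \int[nu]_q ((a * extremal p q) `^ p)%:E = (a `^ p * sphere_volume)%:E.
Proof.
move=> p0 a0.
under eq_integral => q _.
  rewrite powRM ?powR_ge0 ?ltW// extremal_powR// EFinM; over.
rewrite ge0_integralZl_EFin ?powR_ge0//; last first.
  apply/measurable_EFinP; apply: (measurableT_comp measurable_fun_invr).
  by apply: measurable_funX; apply: measurableT_comp => //; exact: measurable_last.
by rewrite integral_extremal sphere_volumeE.
Qed.

Lemma scaled_extremal_ge0 (p a : R) (q : Hn) : (0 < a)%R -> (0 <= a * extremal p q)%R.
Proof. by move=> a0; rewrite mulr_ge0 ?powR_ge0// ltW. Qed.

Lemma Lfun_scaled_extremal (p a : R) : (0 < p)%R -> (0 < a)%R ->
  (fun q : Hn => a * extremal p q)%R \in Lfun nu p%:E.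
Proof.
move=> p0 a0; apply: Lfun_of_integral_powR (integral_scaled_extremal p0 a0).
- by move=> q; exact: scaled_extremal_ge0.
- by apply: measurable_funM => //; exact: measurable_extremal.
Qed.

Lemma Lnorm_scaled_extremal (p a : R) : (0 < p)%R -> (0 < a)%R ->
  'N[nu]_p%:E[EFin \o (fun q : Hn => a * extremal p q)%R] =
  (a * sphere_volume `^ p^-1)%:E.
Proof.
move=> p0 a0; rewrite (Lnorm_nonneg _ (integral_scaled_extremal p0 a0)); last first.
  by move=> q; exact: scaled_extremal_ge0.
rewrite powRM ?powR_ge0 ?(ltW sphere_volume_gt0)// -powRrM mulfV ?gt_eqF//.
by rewrite powRr1// ltW.
Qed.

(** Excludes the value -oo, which the essential supremum takes for the zero measure. *)
Lemma sup_functional_ge0 (p : R) (F G : Hn -> R) :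
  (forall q, 0 <= F q)%R -> (forall q, 0 <= G q)%R -> 0 <= sup_functional p F G.
Proof.
move=> F0 G0; apply: ess_sup_gee; last first.
  by apply: aeW => z; rewrite lee_fin !mulr_ge0// powR_ge0.
have nuT : 0 < nu setT.
  rewrite lt0e measure_ge0 andbT; apply/negP => /eqP nu0.
  have := sphere_volume_gt0; rewrite -lte_fin -sphere_volumeE -integral_extremal.
  rewrite null_set_integral ?ltxx//.
  apply/measurable_EFinP; apply: (measurableT_comp measurable_fun_invr).
  by apply: measurable_funX; apply: measurableT_comp => //; exact: measurable_last.
have E := @product_measure1E _ _ _ _ R nu nu setT setT measurableT measurableT.
rewrite setXTT in E.
by apply: lt_le_trans (mule_gt0 nuT nuT) _; rewrite -E.
Qed.

(** The bound holds for every pair of points, by minkowski_form_le; together with the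
inequality itself it forces equality for the extremal functions. *)
Lemma sup_functional_extremal_le (p a b : R) : (0 < p)%R -> (0 < a)%R -> (0 < b)%R ->
  sup_functional p (fun q : Hn => a * extremal p q)%R (fun q => b * extremal p q)%R <=
  (a * b * 2 `^ (n%:R / p))%:E.
Proof.
move=> p0 a0 b0; apply/ess_supP; apply: aeW => -[q t] /=; rewrite lee_fin.
have np0 : (0 <= n%:R / p)%R by rewrite divr_ge0// ltW.
have q0 : (0 < `|(hval q).2|)%R by rewrite normr_gt0 hval_last_neq0.
have t0 : (0 < `|(hval t).2|)%R by rewrite normr_gt0 hval_last_neq0.
have h : (`|minkowski_form (hval q) (hval t) - 1| `^ (n%:R / p) <=
    2 `^ (n%:R / p) * (`|(hval q).2| `^ (n%:R / p) * `|(hval t).2| `^ (n%:R / p)))%R.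
  rewrite -!powRM// ?mulr_ge0//; apply: ge0_ler_powR; rewrite ?nnegrE ?mulr_ge0 ?invr_ge0 ?(ltW p0)//.
  exact: minkowski_form_le.
apply: (@le_trans _ _ (a * extremal p q * (b * extremal p t) *
  (2 `^ (n%:R / p) * (`|(hval q).2| `^ (n%:R / p) * `|(hval t).2| `^ (n%:R / p)))))%R.
  by rewrite ler_wpM2l// !mulr_ge0 ?powR_ge0// ltW.
rewrite le_eqVlt; apply/orP; left; apply/eqP; rewrite /extremal !powRN.
by field; rewrite !gt_eqF ?powR_gt0.
Qed.

(** Every positive M above the essential supremum gives an inequality; the supremum itself
may vanish, hence the limit over M = S + e / sharp_constant p. *)
Lemma hls_inequality_sharp_constant (p : R) : (0 < p)%R ->
  hls_inequality (n := n) p (sharp_constant p).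
Proof.
move=> p0 F G F0 G0 /(Lfun_integral_powR p0 F0)[mF [P FP]].
move=> /(Lfun_integral_powR p0 G0)[mG [Q GQ]].
have c0 : (0 < sharp_constant p)%R by exact: sharp_constant_gt0.
rewrite (Lnorm_nonneg F0 FP) (Lnorm_nonneg G0 GQ) -EFinM.
have P0 : (0 <= P)%R.
  by rewrite -lee_fin -FP; apply: integral_ge0 => q _; rewrite lee_fin powR_ge0.
have Q0 : (0 <= Q)%R.
  by rewrite -lee_fin -GQ; apply: integral_ge0 => q _; rewrite lee_fin powR_ge0.
have bound (M : R) : (0 < M)%R -> sup_functional p F G <= M%:E ->
    (P `^ p^-1 * Q `^ p^-1 <= sharp_constant p * M)%R.
  move=> M0 /ess_supP aeM.
  have := @hyperboloid_sup_inequality R m (fun q => F q `^ p)%R (fun q => G q `^ p)%R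
    (M `^ p)%R P Q.
  rewrite powR_gt0// => /(_ isT _ _ _ _ _ FP GQ)/wrap[]//.
  - exact: (measurableT_comp (@measurable_powR R p) mF).
  - exact: (measurableT_comp (@measurable_powR R p) mG).
  - by move=> q; exact: powR_ge0.
  - by move=> q; exact: powR_ge0.
  - apply: filterS aeM => -[q t] /=; rewrite lee_fin => h.
    have -> : (`|minkowski_form (hval q) (hval t) - 1| ^+ n =
       (`|minkowski_form (hval q) (hval t) - 1| `^ (n%:R / p)) `^ p)%R.
      by rewrite -powRrM divfK ?gt_eqF// powR_mulrn.
    rewrite -!powRM ?mulr_ge0 ?powR_ge0//.
    by apply: ge0_ler_powR; rewrite ?nnegrE ?mulr_ge0 ?powR_ge0// ltW.
  rewrite -/sphere_volume => H.
  have two0 : (0 < 2 ^+ n :> R)%R by rewrite exprn_gt0.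
  rewrite -powRM// /sharp_constant.
  rewrite powR_root_scaling ?(ltW M0) ?(ltW sphere_volume_gt0)//.
  apply: ge0_ler_powR; rewrite ?invr_ge0 ?nnegrE ?(ltW p0) ?mulr_ge0//.
  - by rewrite powR_ge0.
  - exact/ltW/sphere_volume_gt0.
  - exact/ltW/sphere_volume_gt0.
  - by rewrite ler_pdivlMr// mulrC.
have := sup_functional_ge0 p F0 G0.
move: bound; case: (sup_functional p F G) => [S||] bound//; last first.
  by move=> _; rewrite gt0_muley ?lte_fin// leey.
rewrite lee_fin => S0; rewrite -EFinM lee_fin.
apply/ler_addgt0Pr => e e0.
have := bound (S + e / sharp_constant p)%R.
rewrite lee_fin lerDl (ltW (divr_gt0 e0 c0)) (ltr_wpDl S0 (divr_gt0 e0 c0)) => /(_ isT isT).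
by rewrite mulrDr [(_ * (e / _))%R]mulrC divfK// gt_eqF.
Qed.

End sharp_constant.

Theorem theorem4p5 (R : realType) (n : nat) (p : R)
    (hn : (1 <= n)%N) (hp : 0 < p) :
  exists E : R,
    [/\ hls_inequality (n := n) p E,
        forall E' : R, hls_inequality (n := n) p E' -> E <= E'
      & forall a b : R, 0 < a -> 0 < b ->
          let F := fun q : hyperboloid R n => a * extremal p q in
          let G := fun q : hyperboloid R n => b * extremal p q in
          [/\ F \in Lfun (lorentz_measure R n) p%:E,
              G \in Lfun (lorentz_measure R n) p%:E
            & ('N[lorentz_measure R n]_p%:E[EFin \o F] *
               'N[lorentz_measure R n]_p%:E[EFin \o G]
               = E%:E * sup_functional p F G)%E]].
Proof.
case: n hn => [//|m _]; exists (@sharp_constant R m p).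
have H0 a : 0 < a -> forall q : hyperboloid R m.+1, 0 <= a * extremal p q.
  by move=> a0 q; exact: scaled_extremal_ge0.
have two0 : (0 < 2 `^ (m.+1%:R / p) :> R) by rewrite powR_gt0.
have c0 := @sharp_constant_gt0 R m p.
split; first exact: hls_inequality_sharp_constant.
- move=> E' hE'; have l1 := @ltr01 R.
  have := hE' _ _ (H0 1 l1) (H0 1 l1) (Lfun_scaled_extremal hp l1) (Lfun_scaled_extremal hp l1).
  rewrite Lnorm_scaled_extremal// mul1r -EFinM -expr2 sharp_constantE.
  have S0 := sup_functional_ge0 p (H0 1 l1) (H0 1 l1).
  move: (@sup_functional_extremal_le R m p 1 1 hp l1 l1) S0; rewrite !mul1r.
  case: sup_functional => [S||]//.
  rewrite -EFinM !lee_fin => SM S0 h.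
  have E'0 : 0 < E'.
    rewrite ltNge; apply/negP => E'0; have := le_trans h (mulr_le0_ge0 E'0 S0).
    by rewrite leNgt mulr_gt0.
  by rewrite -(ler_pM2r two0) (le_trans h)// ler_pM2l.
- move=> a b a0 b0 F G; split; [exact: Lfun_scaled_extremal|exact: Lfun_scaled_extremal|].
  apply/eqP; rewrite eq_le; apply/andP; split.
    apply: hls_inequality_sharp_constant => //; [exact: H0|exact: H0|..].
      exact: Lfun_scaled_extremal.
    exact: Lfun_scaled_extremal.
  rewrite !Lnorm_scaled_extremal// -EFinM.
  apply: (@le_trans _ _ ((@sharp_constant R m p)%:E * (a * b * 2 `^ (m.+1%:R / p))%:E)%E).
    by rewrite lee_pmul2l ?lte_fin// sup_functional_extremal_le.
  rewrite -EFinM lee_fin le_eqVlt; apply/orP; left; apply/eqP.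
  by rewrite [RHS]mulrACA -expr2 sharp_constantE; ring.
Qed.
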